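(* Let $X$ be the symplectic toric orbifold corresponding to $(\Sigma(P),\vec{\boldsymbol b})$, let $L\subset X$ be a Lagrangian $T^n$-orbit, and let $(\mathcal D,(z_1^+,\dots,z_k^+))$ be an orbi-disc with $\mathbb Z/m_i\mathbb Z$ singularity at $z_i^+$ ($m_i=1$ being allowed, for smooth marked points). Let $w:(\mathcal D,\partial\mathcal D)\to(X,L)$ be a holomorphic orbi-disc which intersects the toric divisor $D_j$ with multiplicity $m_{i,j}/m_i$ at each marked point $z_i^+$, and which does not intersect the toric divisors away from the marked points. Then the desingularized Maslov index of $w$ is $$\mu^{de}(w)=2\sum_i\sum_j\lfloor m_{i,j}/m_i\rfloor ,$$ where $\lfloor r\rfloor$ denotes the largest integer $\le r$.
   Context: **Toric orbifolds.** $N=\mathbb Z^n$, $M=\mathrm{Hom}(N,\mathbb Z)$, $N_{\mathbb R}=N\otimes\mathbb R$, $M_{\mathbb R}=M\otimes\mathbb R$. A labeled polytope is a compact simple rational convex polytope $P\subset M_{\mathbb R}$ with $m$ facets and a positive integer $c_j$ attached to the $j$-th facet; $\boldsymbol v_j\in N$ is the primitive inward normal to the $j$-th facet and $\boldsymbol b_j=c_j\boldsymbol v_j$ is the $j$-th stacky vector. $P=\{u\in M_{\mathbb R}\mid \langle u,\boldsymbol b_j\rangle\ge\lambda_j,\ j=1,\dots,m\}$, and $\Sigma=\Sigma(P)$ is the normal fan of $P$ (with rays spanned by $\boldsymbol v_j$). A primitive collection is a subset of $\{\boldsymbol v_1,\dots,\boldsymbol v_m\}$ which does not generate a cone of $\Sigma$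 while all of its proper subsets do; $Z(\Sigma)\subset\mathbb C^m$ is the union of the subspaces $\{z_{i_1}=\dots=z_{i_p}=0\}$ over primitive collections $\{\boldsymbol v_{i_1},\dots,\boldsymbol v_{i_p}\}$, and $U(\Sigma)=\mathbb C^m\setminus Z(\Sigma)$. The map $\mathbb Z^m\to N$, $e_j\mapsto\boldsymbol b_j$ induces $T^m\to T^n$ and $(\mathbb C^* )^m\to(\mathbb C^* )^n$ with kernels $K$ and $K_{\mathbb C}$. The toric orbifold is $X=U(\Sigma)/K_{\mathbb C}$, equivalently the symplectic quotient $\mu_K^{-1}(\iota^*(-\lambda))/K$ of $(\mathbb C^m,\frac i2\sum dz_k\wedge d\bar z_k)$ ($\mu_K=\iota^*\circ\frac12(|z_1|^2,\dots,|z_m|^2)$, $\iota:\mathrm{Lie}(K)\to\mathbb R^m$ the inclusion). The residual $T^n$-action has moment map $\mu_T:X\to P$; the Lagrangian $T^n$-orbits are $L(u)=\mu_T^{-1}(u)$, $u\in\mathrm{Int}(P)$. $D_j=\{z_j=0\}/K_{\mathbb C}$ is the $j$-th toric divisor. **Orbi-discs.** An orbi-disc $\mathcal D$ is the closed disc $D^2$ with interior points $z_i^+$ having disc neighbourhoods uniformized by the branched covering $z\mapsto z^{m_i}$. A holomorphic orbi-disc $w:(\mathcal D,\partial\mathcal D)\to(X,L)$ is a continuous map with $w(\partial\mathcal D)\subset L$ having, near each point, a holomorphic lift between uniformizing charts, which is a good orbifold map (with compatible system in the sense of Chen–Ruan, so that local lifts are equivariant for group homomorphisms $\mathbb Z/m_i\to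 G_{w(z_i^+)}$ into the local groups) and is representable (these homomorphisms are injective). The multiplicity of an intersection of $w$ with $D_j$ at $z_i^+$ is the ordinary intersection number in the uniformizing cover (the order of vanishing $m_{i,j}$ at the orbifold point of the coordinate of the lift of $w$ defining $D_j$), divided by the order $m_i$ of the local group of the orbi-disc. **Desingularized Maslov index.** Let $E=w^*TX$, a complex orbi-bundle over $\mathcal D$ with Lagrangian subbundle $w|_{\partial\mathcal D}^*TL$ over the boundary. Near $z_i^+$, $E$ is uniformized by $D_i\times\mathbb C^n$ with $\mathbb Z_{m_i}$ action $e^{2\pi\sqrt{-1}/m_i}\cdot(z,w)=(e^{2\pi\sqrt{-1}/m_i}z,\mathrm{diag}(e^{2\pi\sqrt{-1}\,r_{i,1}/m_i},\dots,e^{2\pi\sqrt{-1}\,r_{i,n}/m_i})w)$ with $0\le r_{i,j}<m_i$. The desingularization $|E|$ is the complex vector bundle over $D^2$ obtained by extending $E|_{\mathcal D\setminus\{z_i^+\}}$ over $z_i^+$ using the trivialization $(z,w_1,\dots,w_n)\mapsto(z^{m_i},z^{-r_{i,1}}w_1,\dots,z^{-r_{i,n}}w_n)$. The desingularized Maslov index $\mu^{de}(w)$ is the ordinary Maslov index of the bundle pair $(|w^*TX|,w|_{\partial\mathcal D}^*TL)$ over $(D^2,\partial D^2)$. *)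

(* Defs.v *)
From HB Require Import structures.
From mathcomp Require Import all_boot all_order all_algebra.
From mathcomp Require Import generic_quotient complex.
From mathcomp Require Import all_classical all_reals all_analysis.

Set Implicit Arguments.
Unset Strict Implicit.
Unset Printing Implicit Defensive.

Import Order.TTheory GRing.Theory Num.Theory.
Import numFieldNormedType.Exports.

Local Open Scope classical_set_scope.
Local Open Scope ring_scope.
Local Open Scope quotient_scope.

(* R[i] is not declared as a topological space, but the coercion of a
   numClosedFieldType to its carrier is. *)
Definition Cx (R : realType) : numClosedFieldType := R[i]%C.

Definition ofR (R : realType) (x : R) : Cx R := (x%:C)%C.
Definition expi (R : realType) (t : R) : Cx R := (cos t +i* sin t)%C.

Definition closed_disc (R : realType) : set (Cx R) := [set p | `|p| <= 1].

Section Polytopes.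
Context {R : realType} {n m : nat}.

(* M_R and N are both written in coordinates: u : 'rV[R]_n, b : 'rV[int]_n. *)
Definition pairing (u : 'rV[R]_n) (b : 'rV[int]_n) : R :=
  \sum_i u ord0 i * (b ord0 i)%:~R.

Definition polyhedron (b : 'I_m -> 'rV[int]_n) (lam : 'I_m -> R) :
    set 'rV[R]_n :=
  [set u | forall j, lam j <= pairing u (b j)].

Definition face_of (b : 'I_m -> 'rV[int]_n) (lam : 'I_m -> R) (j : 'I_m) :
    set 'rV[R]_n :=
  polyhedron b lam `&` [set u | pairing u (b j) = lam j].

Definition active (b : 'I_m -> 'rV[int]_n) (lam : 'I_m -> R) (u : 'rV[R]_n) :
    {set 'I_m} :=
  [set j | pairing u (b j) == lam j]%SET.

Definition vertex (A : set 'rV[R]_n) (u : 'rV[R]_n) : Prop :=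
  A u /\ forall (x y : 'rV[R]_n) (t : R), A x -> A y -> 0 < t < 1 ->
           u = t *: x + (1 - t) *: y -> x = y.

(* The affine hull of A contains n affinely independent points of A. For A
   inside a hyperplane of R^n this says that A has dimension n - 1. *)
Definition full_in_hyperplane (A : set 'rV[R]_n) : Prop :=
  exists p : 'M[R]_n, (forall i, A (row i p)) /\
    row_free (row_mx (const_mx 1 : 'cV[R]_n) p).

Definition primitive_vector (v : 'rV[int]_n) : Prop :=
  forall (d : int) (v' : 'rV[int]_n), v = d *: v' -> `|d| = 1.

End Polytopes.

Record labeled_polytope (R : realType) (n m : nat) := LabeledPolytope {
  normal : 'I_m -> 'rV[int]_n;
  label : 'I_m -> nat;
  offset : 'I_m -> R;
  stacky := fun j => normal j *+ label j;
  polytope := polyhedron stacky offset;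
  normal_primitive : forall j, primitive_vector (normal j);
  label_gt0 : forall j, (0 < label j)%N;
  polytope_compact : compact polytope;
  face_is_facet : forall j, full_in_hyperplane (face_of stacky offset j);
  facet_inj : injective (face_of stacky offset);
  polytope_simple : forall u, vertex polytope u ->
    #|active stacky offset u| = n }.

Section ToricOrbifold.
Context {R : realType} {n m : nat} (P : labeled_polytope R n m).
Local Notation C := (Cx R).

Definition cone (I : {set 'I_m}) : set 'rV[R]_n :=
  [set y | exists2 a : 'I_m -> R, (forall j, 0 <= a j) &
     y = \sum_(j in I) a j *: map_mx intr (normal P j)].

(* Cones are indexed by the faces of the polytope; every nonempty face is the
   smallest face containing some point u, and the facets containing it are then
   those through u. *)
Definition normal_fan : set (set 'rV[R]_n) :=
  [set cone (active (stacky P) (offset P) u) | u in polytope P].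

Definition generates_cone (I : {set 'I_m}) : Prop := normal_fan (cone I).

Definition primitive_collection (I : {set 'I_m}) : Prop :=
  ~ generates_cone I /\
  forall J : {set 'I_m}, J \proper I -> generates_cone J.

Definition Zset : set 'rV[C]_m :=
  [set z | exists2 I, primitive_collection I &
             forall j, j \in I -> z ord0 j = 0].
Definition Uset : set 'rV[C]_m := ~` Zset.

Definition mulc (t z : 'rV[C]_m) : 'rV[C]_m :=
  \row_j (t ord0 j * z ord0 j).

(* Kernel of (C^* )^m -> (C^* )^n, t |-> (prod_j t_j ^ b_{j,i})_i. *)
Definition KC (t : 'rV[C]_m) : Prop :=
  (forall j, t ord0 j != 0) /\
  forall i, \prod_j t ord0 j ^ (stacky P j ord0 i) = 1.

Definition lie_KC (a : 'rV[C]_m) : Prop :=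
  forall i, \sum_j a ord0 j * (stacky P j ord0 i)%:~R = 0.

Definition KC_orbit (z z' : Uset) : bool :=
  `[< exists2 t, KC t & \val z' = mulc t (\val z) >].

Lemma KC_orbit_refl : reflexive KC_orbit.
Proof.
move=> z; apply/asboolP; exists (const_mx 1).
  by split=> [j|i]; [rewrite mxE oner_neq0|rewrite big1// => j _; rewrite mxE exp1rz].
by apply/rowP => j; rewrite !mxE mul1r.
Qed.

Lemma KC_orbit_sym : symmetric KC_orbit.
Proof.
suff H z z' : KC_orbit z z' -> KC_orbit z' z by move=> z z'; apply/idP/idP => /H.
move=> /asboolP[t [t0 t1] zt]; apply/asboolP.
exists (\row_j (t ord0 j)^-1).
  split=> [j|i]; first by rewrite mxE invr_eq0.
  transitivity (\prod_j (t ord0 j ^ (stacky P j ord0 i))^-1); last first.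
    by rewrite prodfV t1 invr1.
  by apply: eq_bigr => j _; rewrite mxE exprz_inv invr_expz.
by apply/rowP => j; rewrite zt !mxE mulrA mulVf// mul1r.
Qed.

Lemma KC_orbit_trans : transitive KC_orbit.
Proof.
move=> z1 z0 z2 /asboolP[t [t0 t1] zt] /asboolP[s [s0 s1] zs]; apply/asboolP.
exists (mulc s t).
  split=> [j|i]; first by rewrite mxE mulf_neq0.
  under eq_bigr do rewrite mxE expfzMl.
  by rewrite big_split/= s1 t1 mulr1.
by apply/rowP => j; rewrite zs zt !mxE mulrA.
Qed.

Canonical KC_equiv :=
  EquivRel KC_orbit KC_orbit_refl KC_orbit_sym KC_orbit_trans.

Definition toric_orbifold := quotient_topology {eq_quot KC_equiv}.

(* x is the class of z. *)
Definition represents (z : 'rV[C]_m) (x : toric_orbifold) : Prop :=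
  exists2 z' : Uset, \val z' = z & \pi_toric_orbifold z' = x.

Definition toric_divisor (j : 'I_m) : set toric_orbifold :=
  [set x | exists2 z, represents z x & z ord0 j = 0].

(* z lies in mu_K^{-1}(iota^* (- lambda)) iff |z_j|^2 / 2 + lambda_j = <u, b_j>
   for some u, because the kernel of iota^* is the image of M_R in R^m; the
   point u is then the value of mu_T at the class of z. *)
Definition moment_value (z : 'rV[C]_m) (u : 'rV[R]_n) : Prop :=
  forall j, `|z ord0 j| ^+ 2 / 2 = ofR (pairing u (stacky P j) - offset P j).

Definition moment_fibre (u : 'rV[R]_n) : set toric_orbifold :=
  [set x | exists2 z, represents z x & moment_value z u].

(* Uniformizing charts. At a vertex of the polytope, s enumerates the n facets
   through it; the chart is C^n, mapped to the slice of U(Sigma) in which the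
   remaining m - n coordinates are 1, with the diagonal local group
   G_s = {g | extend s 1 g \in K_C}. *)
Definition is_chart (s : 'I_n -> 'I_m) : Prop :=
  injective s /\
  exists2 u, vertex (polytope P) u &
    forall j, pairing u (stacky P j) = offset P j <-> exists k, s k = j.

Definition extend (s : 'I_n -> 'I_m) (c : C) (y : 'rV[C]_n) : 'rV[C]_m :=
  \row_j oapp (fun k => y ord0 k) c [pick k | s k == j].

Definition local_group (s : 'I_n -> 'I_m) (g : 'rV[C]_n) : Prop :=
  KC (extend s 1 g).

(* The tangent orbibundle is T U(Sigma) modulo the tangent group of K_C. The
   element t of K_C carries the chart s to the chart s', sending some point of
   the first to y'; xi' is the image of xi under the differential of this change
   of charts. The correction along the K_C-orbit brings t * xi back into the
   slice of s'. *)
Definition dchange (s s' : 'I_n -> 'I_m) (t : 'rV[C]_m) (y' : 'rV[C]_n)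
    (xi xi' : 'rV[C]_n) : Prop :=
  exists2 a, lie_KC a &
    extend s' 0 xi' = mulc t (extend s 0 xi) + mulc a (extend s' 1 y').

(* Tangent space, in the chart s, of the T^n-orbit through the point y: it is
   generated by the infinitesimal action of Lie(T^m) = sqrt(-1) R^m. *)
Definition orbit_tangent (s : 'I_n -> 'I_m) (y : 'rV[C]_n) : set 'rV[C]_n :=
  [set xi | exists (r : 'rV[R]_m) (a : 'rV[C]_m), lie_KC a /\
     extend s 0 xi =
       mulc (map_mx (fun x : R => (0 +i* x)%C : C) r + a) (extend s 1 y)].

End ToricOrbifold.

Arguments toric_divisor {R n m} P j.
Arguments moment_fibre {R n m} P u.

Record orbidisc (R : realType) (k : nat) := Orbidisc {
  mark : 'I_k -> Cx R;
  mark_order : 'I_k -> nat;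
  mark_interior : forall i, `|mark i| < 1;
  mark_inj : injective mark;
  mark_order_gt0 : forall i, (0 < mark_order i)%N }.

Section OrbidiscCharts.
Context {R : realType} {k : nat} (D : orbidisc R k).
Local Notation C := (Cx R).

Definition order_at (x : C) : nat :=
  oapp (mark_order D) 1%N [pick i | mark D i == x].

Definition unif (x zeta : C) : C := x + zeta ^+ order_at x.

Definition unif_dom (rho x : C) : set C :=
  [set zeta | `|zeta| < rho /\ closed_disc (unif x zeta)].

End OrbidiscCharts.

(* A holomorphic orbi-disc with boundary on the fibre over u, with its compatible
   system. Everything is indexed by the points x of the closed disc: around x the
   orbi-disc is uniformized by zeta |-> x + zeta ^ m_x, and ho_lift x is the lift
   to the chart ho_chart x. The generator of Z/m_x goes to ho_hom x. The
   compatible system attaches to every pair (zeta, eta) of points of two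
   uniformizing discs lying over the same point the change of charts of X given
   by the element ho_trans x y zeta eta of K_C. Over an orbifold point x the only
   such pairs have x = y and zeta = eta = 0, where the arrows are the elements of
   Z/m_x and are taken care of by ho_hom. *)
Record holo_orbidisc (R : realType) (n m k : nat) (P : labeled_polytope R n m)
    (u : 'rV[R]_n) (D : orbidisc R k) := HoloOrbidisc {
  ho_map : Cx R -> toric_orbifold P;
  ho_chart : Cx R -> 'I_n -> 'I_m;
  ho_radius : Cx R -> Cx R;
  ho_lift : Cx R -> Cx R -> 'rV[Cx R]_n;
  ho_hom : Cx R -> 'rV[Cx R]_n;
  ho_trans : Cx R -> Cx R -> Cx R -> Cx R -> 'rV[Cx R]_m;
  ho_dom := fun x => unif_dom D (ho_radius x) x;
  ho_overlap := fun x y => [set q : Cx R * Cx R |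
    [/\ ho_dom x q.1, ho_dom y q.2, unif D x q.1 = unif D y q.2 &
        order_at D (unif D x q.1) = 1%N]];
  ho_map_continuous : {within @closed_disc R, continuous ho_map};
  ho_map_boundary : forall p, `|p| = 1 -> moment_fibre P u (ho_map p);
  ho_chartP : forall x, closed_disc x -> is_chart P (ho_chart x);
  ho_radius_gt0 : forall x, closed_disc x -> 0 < ho_radius x;
  ho_domP : forall x, closed_disc x -> forall zeta, ho_dom x zeta ->
    zeta != 0 -> order_at D (unif D x zeta) = 1%N;
  ho_lift_continuous : forall x, closed_disc x ->
    {within ho_dom x, continuous (ho_lift x)};
  ho_lift_holomorphic : forall x, closed_disc x ->
    forall zeta, ho_dom x zeta -> `|unif D x zeta| < 1 ->
    forall l, derivable (fun z => ho_lift x z ord0 l) zeta 1;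
  ho_liftP : forall x, closed_disc x -> forall zeta, ho_dom x zeta ->
    represents (extend (ho_chart x) 1 (ho_lift x zeta)) (ho_map (unif D x zeta));
  ho_hom_local_group : forall x, closed_disc x ->
    local_group P (ho_chart x) (ho_hom x);
  ho_hom_order : forall x, closed_disc x ->
    forall l, ho_hom x ord0 l ^+ order_at D x = 1;
  ho_equivariant : forall x, closed_disc x -> forall zeta, ho_dom x zeta ->
    ho_lift x (expi (2 * pi / (order_at D x)%:R) * zeta) =
    mulc (ho_hom x) (ho_lift x zeta);
  ho_representable : forall x, closed_disc x ->
    forall a, (0 < a < order_at D x)%N -> exists l, ho_hom x ord0 l ^+ a != 1;
  ho_trans_continuous : forall x y, closed_disc x -> closed_disc y ->
    {within ho_overlap x y, continuous (fun q => ho_trans x y q.1 q.2)};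
  ho_transP : forall x y, closed_disc x -> closed_disc y ->
    forall zeta eta, ho_overlap x y (zeta, eta) ->
    KC P (ho_trans x y zeta eta) /\
    extend (ho_chart y) 1 (ho_lift y eta) =
      mulc (ho_trans x y zeta eta) (extend (ho_chart x) 1 (ho_lift x zeta));
  ho_trans_hom : forall x, closed_disc x ->
    forall zeta eta, ho_overlap x x (zeta, eta) ->
    eta = expi (2 * pi / (order_at D x)%:R) * zeta ->
    ho_trans x x zeta eta = extend (ho_chart x) 1 (ho_hom x);
  ho_trans_cocycle : forall x y z,
    closed_disc x -> closed_disc y -> closed_disc z ->
    forall zeta eta theta,
    ho_overlap x y (zeta, eta) -> ho_overlap y z (eta, theta) ->
    ho_trans x z zeta theta =
      mulc (ho_trans y z eta theta) (ho_trans x y zeta eta) }.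

(* Data of a rank n complex vector bundle over the closed disc with a totally
   real subbundle over the boundary circle. There is one local trivialization for
   each point x of the disc, over bp_nbhd x; bp_same x y p v v' says that v and v',
   in the trivializations at x and y, are the same vector of the fibre at p; and
   bp_real p is the totally real subspace at the boundary point p, in the
   trivialization at p. *)
Record bundle_pair (R : realType) (n : nat) := BundlePair {
  bp_nbhd : Cx R -> set (Cx R);
  bp_same : Cx R -> Cx R -> Cx R -> 'rV[Cx R]_n -> 'rV[Cx R]_n -> Prop;
  bp_real : Cx R -> set 'rV[Cx R]_n }.

Section Maslov.
Context {R : realType} {n : nat} (E : bundle_pair R n).
Local Notation C := (Cx R).

(* A global frame: the rows of Psi x p form a basis of the fibre at p, in the
   trivialization at x. *)
Definition global_frame (Psi : C -> C -> 'M[C]_n) : Prop :=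
  [/\ forall x, closed_disc x -> {within bp_nbhd E x, continuous (Psi x)},
      forall x p, closed_disc x -> bp_nbhd E x p -> Psi x p \in unitmx &
      forall x y p, closed_disc x -> closed_disc y ->
        bp_nbhd E x p -> bp_nbhd E y p ->
        forall l, bp_same E x y p (row l (Psi x p)) (row l (Psi y p))].

(* The rows of A form a basis of the real vector space F. *)
Definition real_basis (A : 'M[C]_n) (F : set 'rV[C]_n) : Prop :=
  F = [set map_mx (@ofR R) r *m A | r in [set: 'rV[R]_n]] /\
  forall r : 'rV[R]_n, map_mx (@ofR R) r *m A = 0 -> r = 0.

(* In a global frame the real subspaces become A(theta) R^n, and the Maslov index
   is the degree of the loop det(A)^2 / |det(A)|^2, which does not depend on the
   choice of the real bases A(theta). *)
Definition maslov_index (d : int) : Prop :=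
  exists2 Psi, global_frame Psi &
  exists phi : R -> R,
    [/\ {within `[0, 1], continuous phi},
        forall theta, 0 <= theta <= 1 ->
          let p := expi (2 * pi * theta) in
          exists2 A, real_basis A [set v | bp_real E p (v *m Psi p p)] &
            (\det A) ^+ 2 / `|\det A| ^+ 2 = expi (phi theta) &
        phi 1 - phi 0 = 2 * pi * d%:~R].

End Maslov.

Section Desingularization.
Context {R : realType} {n m k : nat} {P : labeled_polytope R n m}
        {u : 'rV[R]_n} {D : orbidisc R k} (w : holo_orbidisc P u D).
Local Notation C := (Cx R).

(* The r in [0, m_x[ with l-th diagonal entry of the action exp(2 pi i r / m_x). *)
Definition weight (x : C) (l : 'I_n) : nat :=
  oapp (@nat_of_ord _) 0%N
    [pick r : 'I_(order_at D x) |
       ho_hom w x ord0 l == expi (2 * pi * r%:R / (order_at D x)%:R)].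

(* Inverse of (w_l)_l |-> (zeta ^ (- r_l) w_l)_l. *)
Definition resing (x zeta : C) (v : 'rV[C]_n) : 'rV[C]_n :=
  \row_l (zeta ^+ weight x l * v ord0 l).

(* Away from the orbifold points, the vector v of |E| at p is the vector
   resing x zeta v of w^* TX, for any zeta over p; an orbifold point lies in one
   trivialization only. *)
Definition desing_same (x y p : C) (v v' : 'rV[C]_n) : Prop :=
  if order_at D p == 1%N then
    exists zeta eta, [/\ ho_overlap w x y (zeta, eta), unif D x zeta = p &
      dchange P (ho_chart w x) (ho_chart w y) (ho_trans w x y zeta eta)
        (ho_lift w y eta) (resing x zeta v) (resing y eta v')]
  else v = v'.

Definition desingularization : bundle_pair R n := {|
  bp_nbhd := fun x => [set unif D x zeta | zeta in ho_dom w x];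
  bp_same := desing_same;
  bp_real := fun p => orbit_tangent P (ho_chart w p) (ho_lift w p 0) |}.

Definition is_desing_maslov_index (d : int) : Prop :=
  maslov_index desingularization d.

Definition vanishing_order (f : C -> C) (a : nat) : Prop :=
  exists h : C -> C,
    [/\ \forall zeta \near (0 : C), derivable h zeta 1, h 0 != 0 &
        \forall zeta \near (0 : C), f zeta = zeta ^+ a * h zeta].

Definition intersects_with_multiplicity (i : 'I_k) (j : 'I_m) (q : rat) : Prop :=
  exists2 a : nat,
    vanishing_order
      (fun zeta => extend (ho_chart w (mark D i)) 1
                     (ho_lift w (mark D i) zeta) ord0 j) a &
    q = a%:R / (mark_order D i)%:R.

End Desingularization.

(* Main.v *)
(* Off the marked points the image of the disc lies in the open torus orbit,
   where logarithmic derivatives of the homogeneous coordinates trivialize the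
   tangent bundle by N (x) C; along the boundary the Lagrangian subspace is the
   constant i N_R. Near a marked point z_i the coordinates of the lift vanish to
   order m_ij = m_i floor(m_ij / m_i) + r, the desingularization absorbs zeta^r,
   and what is left is the lattice modification with exponents
   f_ij = floor(m_ij / m_i) along the rays b_j. Elementary transformations over
   C[z] produce a polynomial matrix M with det M = prod (z - z_i)^(f_ij) whose
   inverse, in the logarithmic trivialization, is a global frame of the
   desingularized bundle. In this frame the Lagrangian loop is i M R^n, and the
   degree of its squared phase is 2 sum f_ij. Two global frames differ by a
   nonvanishing function on the disc after taking determinants, and such a
   function has winding number zero on the boundary circle. *)
Require Import Defs.
From mathcomp Require Import all_boot all_order all_algebra.
From mathcomp Require Import complex ring lra.
From mathcomp Require Import all_classical all_reals all_analysis.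
Set Implicit Arguments.
Unset Strict Implicit.
Unset Printing Implicit Defensive.
Import Order.TTheory GRing.Theory Num.Theory.
Import numFieldNormedType.Exports.
Local Open Scope classical_set_scope.
Local Open Scope ring_scope.

(** * Polynomial matrices with prescribed elementary divisors *)

(** The stacky vectors at a vertex are a basis over the field but need not be one of the lattice,
    and the bases at distinct marked points are unrelated. This is why [M] is grown one linear
    factor at a time; its exact determinant certifies that nothing degenerates beyond the prescribed
    zeros. A smooth marked point may lie in many trivializations, while the logarithmic derivative
    breaks down there. Frames must therefore be compared across charts without dividing by vanishing
    coordinates: [sigma] extends the quotients over such points, and [lift_row_relation] supplies
    the element of [lie_KC] by linear algebra. As the frame is the inverse of [M], a row [v] of
    frame coefficients is tangent to the orbit when [v M^-1] lies in [i R^n], that is, when [v] lies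
    in [i R^n M]: zeros of [det M] count positively. The factor [i^n] only shifts the phase by a
    constant. Uniqueness concerns arbitrary frames. Their determinant ratio with the explicit one is
    shown to be chart-independent off the marks, and continuity at a mark is checked in the chart
    centred there. *)

Section ElementaryTransformations.
Context {F : fieldType} {n k : nat}.
Implicit Types (z : 'I_k -> F) (B : 'I_k -> 'M[F]_n) (f : 'I_k -> 'I_n -> nat).

Lemma polymx_factor_rows (d : 'I_n -> {poly F}) (A : 'M[{poly F}]_n) :
  (forall l c, d l %| A l c) ->
  exists N, A = diag_mx (\row_l d l) *m N.
Proof.
move=> dA; exists (\matrix_(l, c) (A l c %/ d l)); apply/matrixP => l c.
by rewrite mul_diag_mx !mxE mulrC divpK.
Qed.

(** [Q] is the diagonal matrix with entry ['X - z] at [l], conjugated by the constant matrix [N(z)].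
    At [z] the product [N Q] becomes [D(z) N(z)], whose row [l] vanishes. *)
Lemma modification_step (z : F) (N : 'M[{poly F}]_n) (l : 'I_n) :
  map_mx (horner_eval z) N \in unitmx ->
  exists Q : 'M[{poly F}]_n, \det Q = 'X - z%:P /\
    forall c, 'X - z%:P %| (N *m Q) l c.
Proof.
set Nz := map_mx _ N => Nu.
pose c := invmx Nz.
pose D : 'M[{poly F}]_n := diag_mx (\row_j if j == l then 'X - z%:P else 1).
exists (map_mx polyC c *m D *m map_mx polyC Nz); split.
  rewrite !det_mulmx mulrAC -det_mulmx -map_mxM mulVmx// map_mx1 det1 mul1r.
  rewrite det_diag (bigD1 l)//= mxE eqxx big1 ?mulr1// => j jl.
  by rewrite mxE (negbTE jl).
move=> b; rewrite dvdp_XsubCl rootE.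
suff : map_mx (horner_eval z) (N *m (map_mx polyC c *m D *m map_mx polyC Nz)) l b = 0.
  by rewrite mxE /horner_eval /= => /eqP.
have eC (A : 'M[F]_n) : map_mx (horner_eval z) (map_mx polyC A) = A.
  by apply/matrixP => i j; rewrite !mxE /horner_eval hornerC.
rewrite !map_mxM !eC -/Nz !mulmxA mulmxV// mul1mx.
have -> : map_mx (horner_eval z) D = diag_mx (\row_j (if j == l then 0 else 1)).
  apply/matrixP => i j; rewrite !mxE /horner_eval /=.
  have [->|ij] := eqVneq i j; last by rewrite !mulr0n horner0.
  by rewrite !mulr1n; case: eqVneq; rewrite ?hornerE ?subrr.
by rewrite mul_diag_mx !mxE eqxx mul0r.
Qed.

(** Induction on the sum of the exponents: lower one of them by 1, then restore it by a
    [modification_step]. Right multiplication by [Q] only combines entries of one row, so the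
    divisibilities already obtained survive. *)
Lemma polymx_of_divisors z B f : injective z -> (forall i, B i \in unitmx) ->
  exists M : 'M[{poly F}]_n,
    \det M = \prod_i \prod_l ('X - (z i)%:P) ^+ f i l /\
    forall i l c, ('X - (z i)%:P) ^+ f i l %| (map_mx polyC (B i) *m M) l c.
Proof.
move=> zI Bu.
have [s] := ubnP (\sum_i \sum_l f i l).
elim: s f => // s IH f; rewrite ltnS => fs.
have [f0|[i [l fil]]] : (forall i l, f i l = 0%N) \/ exists i l, (0 < f i l)%N.
  case: (pickP (fun il : 'I_k * 'I_n => 0 < f il.1 il.2)%N) => [[i l]|H].
    by right; exists i, l.
  by left=> i l; apply/eqP; rewrite -leqn0 leqNgt; apply/negbT/(H (i, l)).
  exists 1%:M; split.
    by rewrite det1 big1// => i _; rewrite big1// => l _; rewrite f0.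
  by move=> i l c; rewrite f0 expr0 dvd1p.
pose f' i' l' := (f i' l' - ((i' == i) && (l' == l)))%N.
have f'E i' l' : f i' l' = (f' i' l' + ((i' == i) && (l' == l)))%N.
  rewrite /f' subnK//; case: eqVneq => //= ->; case: eqVneq => //= ->.
  exact: fil.
have {fs} : (\sum_i \sum_l f' i l < s)%N.
  apply: leq_trans fs.
  under [X in (_ < X)%N]eq_bigr do under eq_bigr do rewrite f'E.
  under [X in (_ < X)%N]eq_bigr do rewrite big_split/=.
  rewrite big_split/= -addn1 leq_add2l.
  by rewrite (bigD1 i)//= (bigD1 l)//= !eqxx.
move=> /IH[M [dM rM]].
have [N BM] := polymx_factor_rows (rM i).
(* The powers of ['X - z i] cancel between the two determinants. What remains is [det (B i)] times
   factors at the other points, which are nonzero at [z i] by injectivity. *)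
have Nu : map_mx (horner_eval (z i)) N \in unitmx.
  rewrite unitmxE det_map_mx /horner_eval unitfE.
  have /(congr1 determinant) := BM.
  rewrite !det_mulmx det_diag dM (bigD1 i)//= det_map_mx.
  under [X in _ = X * _]eq_bigr do rewrite mxE.
  rewrite mulrCA => /mulfI <-; last first.
    by apply/prodf_neq0 => a _; rewrite expf_neq0// polyXsubC_eq0.
  rewrite /horner_eval hornerM hornerC mulf_neq0//.
    by have := Bu i; rewrite unitmxE unitfE.
  rewrite horner_prod; apply/prodf_neq0 => a ai.
  rewrite horner_prod; apply/prodf_neq0 => b _.
  rewrite horner_exp expf_neq0// !hornerE subr_eq0.
  by apply: contra ai => /eqP/zI ->.
have [Q [dQ rQ]] := modification_step l Nu.
exists (M *m Q); split.
  rewrite det_mulmx dM dQ.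
  under [RHS]eq_bigr do under eq_bigr do rewrite f'E exprD.
  under [RHS]eq_bigr do rewrite big_split/=.
  rewrite big_split/=; congr (_ * _).
  rewrite (bigD1 i)//= (bigD1 l)//= !eqxx/= expr1 big1 ?mulr1.
    by rewrite big1 ?mulr1// => a ai; rewrite (negbTE ai) big1.
  by move=> a al; rewrite (negbTE al).
move=> a b c; rewrite f'E mulmxA; have [->|ai] := eqVneq a i => /=; last first.
  rewrite addn0 mxE; elim/big_ind: _ => [|x y|e _]; first exact: dvdp0.
    exact: dvdp_add.
  exact/dvdp_mulr/rM.
rewrite BM -mulmxA mul_diag_mx !mxE exprD dvdp_mul//.
have [->|_] := eqVneq b l; last by rewrite dvd1p.
by rewrite expr1; have := rQ c; rewrite mxE.
Qed.

End ElementaryTransformations.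

(** * Linear algebra behind the changes of chart *)

Section SelectedRows.
Context {K : comNzRingType} {n m : nat} (s : 'I_n -> 'I_m).
Hypothesis s_inj : injective s.

Definition select_mx : 'M[K]_(n, m) := \matrix_(l, j) (s l == j)%:R.

Lemma mul_select_mx p (A : 'M[K]_(m, p)) : select_mx *m A = rowsub s A.
Proof.
apply/matrixP => l c; rewrite !mxE (bigD1 (s l))//= mxE eqxx mul1r big1 ?addr0// => j.
by rewrite mxE eq_sym => /negbTE ->; rewrite mul0r.
Qed.

Lemma row_select_in (y : 'rV[K]_n) l : (y *m select_mx) ord0 (s l) = y ord0 l.
Proof.
rewrite mxE (bigD1 l)//= mxE eqxx mulr1 big1 ?addr0// => l' l'l.
by rewrite mxE (inj_eq s_inj) (negbTE l'l) mulr0.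
Qed.

Lemma row_select_out (y : 'rV[K]_n) j : j \notin codom s -> (y *m select_mx) ord0 j = 0.
Proof.
move=> js; rewrite mxE big1// => l _; rewrite mxE.
by case: eqP => [e|_]; [rewrite -e codom_f in js|rewrite mulr0].
Qed.

End SelectedRows.

(* Where [van] is nonzero one divides by it; the remaining rows are selected by
   [s], and their coefficients are determined by the invertibility of the two
   selected submatrices. *)
Lemma lift_row_relation (K : fieldType) (n m : nat) (s : 'I_n -> 'I_m)
    (A N : 'M[K]_(m, n)) (M : 'M[K]_n) (van : 'I_m -> K)
    (d : 'rV[K]_m) : injective s ->
  (forall j, j \notin codom s -> van j != 0) ->
  A *m M = diag_mx (\row_j van j) *m N ->
  rowsub s A \in unitmx -> rowsub s N \in unitmx -> d *m N = 0 ->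
  exists a : 'rV[K]_m, a *m A = 0 /\ forall j, d ord0 j = a ord0 j * van j.
Proof.
move=> s_inj van_out AM uA uN dN.
pose d0 : 'rV[K]_m := \row_j (if van j == 0 then d ord0 j else 0).
pose d1 : 'rV[K]_m := \row_j (if van j == 0 then 0 else d ord0 j / van j).
have dE : d = d0 + d1 *m diag_mx (\row_j van j).
  apply/rowP => j; rewrite mul_mx_diag !mxE; case: eqVneq => vj; first by rewrite mul0r addr0.
  by rewrite add0r divfK.
pose ds : 'rV[K]_n := \row_l d0 ord0 (s l).
have d0E : d0 = ds *m select_mx s.
  apply/rowP => j; have [/codomP[l ->]|js] := boolP (j \in codom s).
    by rewrite (row_select_in s_inj) [RHS]mxE.
  by rewrite row_select_out// [LHS]mxE (negbTE (van_out _ js)).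
pose om := d1 *m A *m invmx (rowsub s A).
have omA : om *m rowsub s A = d1 *m A by rewrite /om -mulmxA mulVmx// mulmx1.
(* By [dE], [d N = 0] reads [d0 N + d1 A M = 0]. Here [d1 A] is [om] times the selected rows of [A],
   and the selected rows of [N] can then be cancelled. *)
have key : om *m diag_mx (\row_l van (s l)) + ds = 0.
  apply: (can_inj (mulmxK uN)); rewrite mul0mx mulmxDl.
  have -> : om *m diag_mx (\row_l van (s l)) *m rowsub s N = d1 *m A *m M.
    have -> : d1 *m A *m M = om *m (rowsub s A *m M) by rewrite mulmxA omA.
    have -> : rowsub s A *m M = rowsub s (diag_mx (\row_j van j) *m N).
      by rewrite -AM -!mul_select_mx mulmxA.
    rewrite -mulmxA.
    by congr (_ *m _); apply/matrixP => l c; rewrite mul_diag_mx [RHS]mxE mul_diag_mx !mxE.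
  rewrite -mul_select_mx mulmxA -d0E -mulmxA AM mulmxA -mulmxDl.
  by rewrite addrC -dE.
have keyl l : om ord0 l * van (s l) + ds ord0 l = 0.
  by have /rowP/(_ l) := key; rewrite mul_mx_diag !mxE.
(* Where [van] is nonzero, [d0] is 0 by definition; where it vanishes, [keyl] itself says so. *)
have ds0 l : ds ord0 l = 0.
  have := keyl l; rewrite !mxE; case: eqVneq => [->|_ _ //].
  by rewrite mulr0 add0r.
(* Subtracting [om] on the selected rows brings [d1] into the kernel of [A]. The products with [van]
   are unchanged, since [keyl] now reads [om * van = 0]. *)
exists (d1 - om *m select_mx s); split.
  by rewrite mulmxBl -mulmxA mul_select_mx omA subrr.
move=> j; rewrite {1}dE mul_mx_diag !mxE mulrBl [X in X + _](_ : _ = 0); last first.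
  have [vj|//] := eqVneq (van j) 0.
  have [/codomP[l e]|/van_out] := boolP (j \in codom s); last by rewrite vj eqxx.
  by have := ds0 l; rewrite !mxE -e vj eqxx.
rewrite add0r -[LHS]subr0; congr (_ - _); apply: esym.
have [/codomP[l ->]|js] := boolP (j \in codom s); last first.
  by have := row_select_out om js; rewrite mxE => ->; rewrite mul0r.
have := row_select_in s_inj om l; rewrite mxE => ->.
by have := keyl l; rewrite ds0 addr0.
Qed.

Lemma row_mulmx_eq (K : comNzRingType) (n p : nat) (X Y : 'M[K]_n) (L L' : 'M[K]_(n, p)) :
  (forall l, row l X *m L = row l Y *m L') -> X *m L = Y *m L'.
Proof. by move=> H; apply/row_matrixP => l; rewrite !row_mul. Qed.

(** [L] and [L'] are meant as the logarithmic matrices of two charts. Both determinants change by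
    the same factor [det L / det L'], which cancels in the quotient. *)
Lemma det_ratio_eq (K : fieldType) (n : nat) (X X0 Y Y0 L L' : 'M[K]_n) :
  X0 \in unitmx -> Y0 \in unitmx -> L \in unitmx -> L' \in unitmx ->
  X *m L = Y *m L' -> X0 *m L = Y0 *m L' -> \det Y / \det Y0 = \det X / \det X0.
Proof.
rewrite !unitmxE !unitfE => x0 y0 l0 l'0 /(congr1 determinant) + /(congr1 determinant).
rewrite !det_mulmx => e e0; apply/eqP; rewrite eqr_div//; apply/eqP.
apply: (mulIf l0); apply: (mulIf l'0).
transitivity (\det Y * \det L' * (\det X0 * \det L)); first by ring.
by rewrite -e e0; ring.
Qed.

(** In the application [a] is the local unit and [b] the vanishing polynomial of each chart facet.
    Both chart-dependent factors cancel, leaving a matrix common to all charts. *)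
Lemma invmx_factor_diag (K : fieldType) (n : nat) (N M B : 'M[K]_n) (a b : 'I_n -> K) :
  N \in unitmx -> M \in unitmx -> (forall l, a l != 0) -> (forall l, b l != 0) ->
  B *m M = diag_mx (\row_l b l) *m N ->
  invmx N *m diag_mx (\row_l a l) *m (diag_mx (\row_l (a l * b l)^-1) *m B) = invmx M.
Proof.
move=> uN uM a0 b0 BM; apply: (can_inj (mulmxK uM)); rewrite (mulVmx uM).
have D1 : diag_mx (\row_l a l) *m diag_mx (\row_l (a l * b l)^-1) *m
    diag_mx (\row_l b l) = 1%:M.
  rewrite !mulmx_diag -diag_const_mx; congr diag_mx; apply/rowP => l.
  by rewrite !mxE invfM mulrA divff// mul1r mulVf.
rewrite -(mulVmx uN) -!mulmxA; congr (_ *m _).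
by rewrite BM !mulmxA D1 mul1mx.
Qed.

(** * Limits of matrices and complex phases *)

Section MatrixLimits.
Context {K : numFieldType} {T : Type} {F : set_system T} {FF : Filter F}.

Lemma cvg_mx (m n : nat) (f : T -> 'M[K]_(m, n)) (l : 'M[K]_(m, n)) :
  (forall i j, f x i j @[x --> F] --> l i j) -> f @ F --> l.
Proof.
move=> fl A [P lP PA]; rewrite nbhs_simpl/=.
near do apply: PA.
by apply: filter_forall => i; apply: filter_forall => j; exact/fl/lP.
Unshelve. all: by end_near. Qed.

Lemma cvg_coord (m n : nat) (f : T -> 'M[K]_(m, n)) (l : 'M[K]_(m, n)) i j :
  f @ F --> l -> f x i j @[x --> F] --> l i j.
Proof.
move=> fl; apply: (@cvg_comp _ _ _ f (fun M => M i j) F (nbhs l)) => //.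
exact: coord_continuous.
Qed.

Lemma cvg_sumr (I : Type) (r : seq I) (P : pred I) (f : I -> T -> K) (l : I -> K) :
  (forall i, P i -> f i @ F --> l i) ->
  \sum_(i <- r | P i) f i x @[x --> F] --> \sum_(i <- r | P i) l i.
Proof.
move=> fl; apply: cvg_big => //; exact: add_continuous.
Qed.

Lemma cvg_prodr (I : Type) (r : seq I) (P : pred I) (f : I -> T -> K) (l : I -> K) :
  (forall i, P i -> f i @ F --> l i) ->
  \prod_(i <- r | P i) f i x @[x --> F] --> \prod_(i <- r | P i) l i.
Proof.
move=> fl; apply: cvg_big => //; exact: mul_continuous.
Qed.

Lemma cvg_det n (f : T -> 'M[K]_n) l : f @ F --> l -> \det (f x) @[x --> F] --> \det l.
Proof.
move=> fl; apply: cvg_sumr => s _; apply: cvgM; first exact: cvg_cst.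
by apply: cvg_prodr => i _; exact: cvg_coord.
Qed.

Lemma cvg_adj n (f : T -> 'M[K]_n) l : f @ F --> l -> \adj (f x) @[x --> F] --> \adj l.
Proof.
move=> fl; apply: cvg_mx => i j; rewrite mxE.
under eq_cvg do rewrite mxE.
apply: cvgM; first exact: cvg_cst.
apply: cvg_det; apply: cvg_mx => a b; rewrite !mxE.
under eq_cvg do rewrite !mxE.
exact: cvg_coord.
Qed.

Lemma cvg_mulmx m n p (f : T -> 'M[K]_(m, n)) (g : T -> 'M[K]_(n, p))
    (a : 'M[K]_(m, n)) (b : 'M[K]_(n, p)) :
  f @ F --> a -> g @ F --> b -> f x *m g x @[x --> F] --> a *m b.
Proof.
move=> fa gb; apply: cvg_mx => i j; rewrite mxE.
under eq_cvg do rewrite mxE.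
by apply: cvg_sumr => c _; apply: cvgM; exact: cvg_coord.
Qed.

Lemma cvg_invmx n (f : T -> 'M[K]_n) (l : 'M[K]_n) : l \in unitmx -> f @ F --> l ->
  invmx (f x) @[x --> F] --> invmx l.
Proof.
move=> lu fl; have fd := cvg_det fl.
have l0 : \det l != 0 by rewrite unitmxE unitfE in lu.
have L : (fun x => (\det (f x))^-1 *: \adj (f x)) @ F --> invmx l.
  rewrite /invmx lu; apply: cvg_mx => i j; rewrite mxE.
  under eq_cvg do rewrite mxE.
  apply: cvgM; first exact: cvgV.
  exact/cvg_coord/cvg_adj.
apply: cvg_trans L; apply: near_eq_cvg.
have : \forall x \near F, \det (f x) != 0 by exact: cvgr_neq0 fd l0.
by apply: filterS => x x0; rewrite /invmx unitmxE unitfE x0.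
Qed.

Lemma cvg_expr (f : T -> K) (l : K) a : f @ F --> l -> f x ^+ a @[x --> F] --> l ^+ a.
Proof.
move=> fl; elim: a => [|a IH]; first exact: cvg_cst.
by rewrite exprS; under eq_cvg do rewrite exprS; exact: cvgM.
Qed.

Lemma cvg_natmul (f : T -> K) (l : K) a : f @ F --> l -> f x *+ a @[x --> F] --> l *+ a.
Proof.
move=> fl; elim: a => [|a IH]; first exact: cvg_cst.
by rewrite mulrS; under eq_cvg do rewrite mulrS; exact: cvgD.
Qed.

Lemma cvg_horner (f : T -> K) (l : K) (p : {poly K}) :
  f @ F --> l -> p.[f x] @[x --> F] --> p.[l].
Proof.
move=> fl; rewrite horner_coef; under eq_cvg do rewrite horner_coef.
by apply: cvg_sumr => i _; apply: cvgM; [exact: cvg_cst|exact: cvg_expr].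
Qed.

End MatrixLimits.

(** * The complex exponential and an argument on the right half-plane *)

Section ComplexNumbers.
Context {R : realType}.
Local Notation C := (Cx R).
Local Notation RRe := (@complex.Re R : C -> R).
Local Notation RIm := (@complex.Im R : C -> R).

Lemma ofR_gt0P (e : C) : 0 < e -> exists2 r : R, 0 < r & e = ofR r.
Proof.
case: e => a b; rewrite ltcE /= => /andP[/eqP -> a0]; by exists a.
Qed.

Lemma ofR_gt0 (r : R) : (0 < ofR r) = (0 < r).
Proof. exact: (ltcR 0 r). Qed.

Lemma norm_ofR (r : R) : `|ofR r| = ofR `|r|.
Proof. by rewrite /ofR normc_def /= expr0n/= addr0 sqrtr_sqr. Qed.

Lemma norm_Re_le (z : C) : ofR `|RRe z| <= `|z|.
Proof. exact: normc_ge_Re. Qed.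

Lemma norm_Im_le (z : C) : ofR `|RIm z| <= `|z|.
Proof.
rewrite normc_def lecR -sqrtr_sqr ler_wsqrtr// lerDr; exact: sqr_ge0.
Qed.

Lemma norm_cplx_le (a b : R) : `|(a +i* b)%C : C| <= ofR (`|a| + `|b|).
Proof.
rewrite normc_def lecR /= -[leRHS]ger0_norm ?addr_ge0// -sqrtr_sqr ler_wsqrtr//.
by rewrite sqrrD !real_normK ?num_real// lerD2r lerDl mulrn_wge0// mulr_ge0.
Qed.

Lemma continuous_cplx T (F : set_system T) {FF : Filter F} (f g : T -> R) (a b : R) :
  f @ F --> a -> g @ F --> b -> (fun x => (f x +i* g x)%C : C) @ F --> ((a +i* b)%C : C).
Proof.
move=> /cvgrPdist_lt fa /cvgrPdist_lt gb; apply/(@cvgrPdist_lt C C) => e /ofR_gt0P[r r0 ->].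
have r2 : 0 < r / 2 by rewrite divr_gt0.
near=> x.
apply: (@le_lt_trans _ _ (ofR (`|a - f x| + `|b - g x|))).
  exact: norm_cplx_le.
rewrite ltcR (splitr r) ltrD//; near: x; [exact: fa|exact: gb].
Unshelve. all: by end_near. Qed.

Lemma continuous_Re : continuous RRe.
Proof.
move=> z; apply/(@cvgrPdist_lt R R C (nbhs z)) => e e0.
have : nbhs z (ball z (ofR e)) by apply: nbhsx_ballx; rewrite ofR_gt0.
apply: filterS => x zx; rewrite -ltcR; apply: le_lt_trans zx.
by rewrite -raddfB; exact: norm_Re_le.
Qed.

Lemma continuous_Im : continuous RIm.
Proof.
move=> z; apply/(@cvgrPdist_lt R R C (nbhs z)) => e e0.
have : nbhs z (ball z (ofR e)) by apply: nbhsx_ballx; rewrite ofR_gt0.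
apply: filterS => x zx; rewrite -ltcR; apply: le_lt_trans zx.
by rewrite -raddfB; exact: norm_Im_le.
Qed.

Lemma continuous_expi : continuous (@expi R).
Proof.
by move=> x; apply: continuous_cplx; [exact: continuous_cos|exact: continuous_sin].
Qed.

Lemma expi0 : expi 0 = 1 :> C.
Proof. by rewrite /expi cos0 sin0. Qed.

Lemma expiD (a b : R) : expi (a + b) = expi a * expi b.
Proof. by rewrite /expi cosD sinD; apply/eqP; rewrite eq_complex /= eqxx addrC eqxx. Qed.

Lemma expi_pi : expi pi = -1 :> C.
Proof. by rewrite /expi cospi sinpi; apply/eqP; rewrite eq_complex /= oppr0 !eqxx. Qed.

Lemma expi_pihalf : expi (pi / 2) = 'i%C :> C.
Proof. by rewrite /expi cos_pihalf sin_pihalf. Qed.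

Lemma expi_2pi : expi (2 * pi) = 1 :> C.
Proof. by rewrite mulr_natl mulr2n expiD expi_pi mulrNN mulr1. Qed.

Lemma expiMn (a : R) (k : nat) : expi (a *+ k) = expi a ^+ k :> C.
Proof. by elim: k => [|k IH]; rewrite ?expi0// mulrS exprS expiD IH. Qed.

Lemma norm_expi (a : R) : `|expi a| = 1 :> C.
Proof. by rewrite normc_def /= cos2Dsin2 sqrtr1. Qed.

Lemma expi_neq0 (a : R) : expi a != 0 :> C.
Proof. by rewrite -normr_eq0 norm_expi oner_eq0. Qed.

Lemma expi_eq1 (a : R) : 0 <= a <= pi -> expi a = 1 -> a = 0.
Proof.
move=> /andP[a0 api] [ca _]; apply: cos_inj; rewrite ?in_itv/= ?a0 ?lexx ?pi_ge0//.
by rewrite cos0.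
Qed.

(** The branch of the argument on [Re z > 0]. All angles below are sums of such arguments and of
    linear terms, so no global logarithm is involved. *)
Definition right_arg (z : C) : R := atan (RIm z / RRe z).

Lemma right_argP (z : C) : 0 < RRe z -> z / `|z| = expi (right_arg z).
Proof.
case: z => a b /= a0; rewrite /right_arg /expi /=.
have s0 : 0 < a ^+ 2 + b ^+ 2.
  by rewrite ltr_wpDr ?sqr_ge0// exprn_gt0.
have sE : 1 + (b / a) ^+ 2 = (a ^+ 2 + b ^+ 2) / a ^+ 2.
  by rewrite mulrDl divff ?expf_neq0 ?gt_eqF// expr_div_n.
have cE : cos (atan (b / a)) = a / Num.sqrt (a ^+ 2 + b ^+ 2).
  rewrite cos_atan sE sqrtrM ?ltW// sqrtrV ?sqr_ge0// sqrtr_sqr gtr0_norm//.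
  by rewrite invf_div.
have sinE : sin (atan (b / a)) = b / Num.sqrt (a ^+ 2 + b ^+ 2).
  have c0 : cos (atan (b / a)) != 0 by rewrite cE gt_eqF// divr_gt0// sqrtr_gt0.
  have /eqP := atanK (b / a); rewrite /tan eqr_div ?(lt0r_neq0 a0)// => /eqP e.
  apply: (mulIf (lt0r_neq0 a0)); rewrite e cE; ring.
have n0 : Num.sqrt (a ^+ 2 + b ^+ 2) != 0 by rewrite gt_eqF// sqrtr_gt0.
rewrite cE sinE normc_def.
apply: (canLR (mulfK _)); first by rewrite eq_complex /= negb_and n0.
by apply/eqP; rewrite eq_complex /= !(mulr0, subr0, add0r) !divfK// !eqxx.
Qed.

Lemma continuous_right_arg (z : C) : 0 < RRe z -> {for z, continuous right_arg}.
Proof.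
move=> z0; apply: (@cvg_comp C R R (fun w => RIm w / RRe w) (@atan R) (nbhs z)
    (nbhs (RIm z / RRe z))); last exact: continuous_atan.
apply: (@cvgM R C (nbhs z) _ RIm (fun w => (RRe w)^-1)).
  exact: continuous_Im.
by apply: (@cvgV R C (nbhs z) _ RRe); [rewrite gt_eqF|exact: continuous_Re].
Qed.

End ComplexNumbers.

(** * Winding number zero for nonvanishing functions on the disc *)

Section WindingOnDisc.
Context {R : realType}.
Local Notation C := (Cx R).
Local Notation RRe := (@complex.Re R : C -> R).

Lemma within_continuous_cvg (X Y : topologicalType) (T : Type) (F : set_system T)
    {FF : Filter F} (D : set X) (g : X -> Y) (f : T -> X) (l : X) :
  {within D, continuous g} -> D l -> f @ F --> l ->
  (\forall x \near F, D (f x)) -> g (f x) @[x --> F] --> g l.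
Proof.
move=> /subspace_continuousP gc Dl fl FD A /(gc _ Dl).
rewrite !nbhs_simpl/= => DA.
have : \forall x \near F, D (f x) -> A (g (f x)) by exact: (fl _ DA).
by apply: filterS2 FD => x Dx; exact.
Qed.

Lemma compact_closed_disc : compact (@closed_disc R).
Proof.
pose q (p : R * R) : C := (p.1 +i* p.2)%C.
have qc : compact (q @` (`[-1, 1] `*` `[-1, 1])).
  apply: continuous_compact; last by apply: compact_setX; exact: segment_compact.
  apply: continuous_subspaceT => -[a b].
  by apply: (@continuous_cplx R _ (nbhs (a, b)) _ fst snd a b); [exact: cvg_fst|exact: cvg_snd].
apply: (subclosed_compact _ qc).
  have -> : @closed_disc R = (fun z : C => RRe `|z|) @^-1` [set x | x <= 1].
    by apply/seteqP; split => -[a b]; rewrite /closed_disc/= normc_def (lecR _ 1).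
  apply: preimage_closed; last exact: closed_le.
  move=> z _; apply: (@cvg_comp C C R Num.norm RRe (nbhs z) (nbhs `|z|)).
    exact: norm_continuous.
  exact: continuous_Re.
move=> [a b] /= z1; exists (a, b) => //=; rewrite !in_itv/=.
split; rewrite -ler_norml -lecR; apply: le_trans z1.
  exact: (norm_Re_le (a +i* b)%C).
exact: (norm_Im_le (a +i* b)%C).
Qed.

(** A Lebesgue-number argument: near each point of the disc, ratios of values of [g] are within 1 of
    1, and compactness makes the distance uniform. *)
Lemma continuous_ratio_near1 (g : C -> C) :
  {within @closed_disc R, continuous g} ->
  (forall z, closed_disc z -> g z != 0) ->
  exists2 d : R, 0 < d & forall z z', closed_disc z -> closed_disc z' ->
    `|z - z'| < ofR d -> 0 < RRe (g z' / g z).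
Proof.
move=> gc g0.
have Re1 (w : C) : `|w - 1| < 1 -> 0 < RRe w.
  move=> w1; have := le_lt_trans (norm_Re_le (w - 1)) w1.
  by rewrite (ltcR _ 1) raddfB /= ltr_norml => /andP[+ _]; rewrite ltrBrDl addrN.
(* The distance is the modulus of a parameter [e] tending to 0, so that the near-covering form of
   compactness applies. *)
pose P (e z : C) := forall z', closed_disc z -> closed_disc z' ->
  `|z - z'| < `|e| -> 0 < RRe (g z' / g z).
have /compact_near_coveringP/near_covering_withinP := compact_closed_disc.
move=> /(_ C (nbhs (0 : C)) P _) [].
  move=> x Dx.
  have /subspace_continuousP/(_ _ Dx)/cvgrPdist_lt := gc.
  (* With tolerance one quarter, [g z] and [g z'] differ by less than [|g x| / 2], while [|g z|]
     exceeds three quarters of [|g x|]. *)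
  have gx0 : 0 < `|g x| / 4 by rewrite divr_gt0// normr_gt0 g0.
  move=> /(_ _ gx0); rewrite near_withinE => /nbhs_ballP[r /= r0 xr].
  have r2 : 0 < r / 2 by rewrite divr_gt0.
  exists (ball (x : C) (r / 2) : set C, ball (0 : C) (r / 2) : set C) => /=.
    by split; exact: (@nbhsx_ballx C C).
  move=> [z e] /= [xz er] Dz z' _ Dz' zz'.
  have gz : `|g x - g z| < `|g x| / 4.
    by apply: xr => //; apply: le_ball xz; rewrite ler_pdivrMr// ler_pMr// ler1n.
  have gz' : `|g x - g z'| < `|g x| / 4.
    apply: xr => //; rewrite /ball/= (splitr r).
    have -> : x - z' = (x - z) + (z - z') by ring.
    apply: le_lt_trans (ler_normD _ _) _; apply: ltrD => //.
    by apply: lt_trans zz' _; move: er; rewrite /ball/= sub0r normrN.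
  apply: Re1.
  have -> : g z' / g z - 1 = (g z' - g z) / g z by rewrite mulrBl divff// g0.
  rewrite normf_div ltr_pdivrMr ?normr_gt0 ?g0// mul1r.
  have -> : g z' - g z = (g x - g z) - (g x - g z') by ring.
  apply: le_lt_trans (ler_normB _ _) _.
  apply: lt_trans (ltrD gz gz') _.
  have : `|g x| - `|g z| < `|g x| / 4.
    exact: le_lt_trans (lerB_dist _ _) gz.
  rewrite ltrBlDr -(ltrD2r (`|g x| / 4)) [`|g x| / 4 + `|g z|]addrC.
  apply: le_lt_trans.
  have -> : `|g x| / 4 + `|g x| / 4 + `|g x| / 4 = `|g x| - `|g x| / 4 by field.
  by rewrite gerBl divr_ge0.
move=> e /= /ofR_gt0P[r r0 ->] erP; exists (r / 2); first by rewrite divr_gt0.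
have r2 : 0 < r / 2 by rewrite divr_gt0.
move=> z z' Dz Dz' zz'; apply: (erP (ofR (r / 2)) _ z Dz z') => //.
  rewrite /= sub0r normrN norm_ofR ltcR (gtr0_norm r2).
  by rewrite ltr_pdivrMr// ltr_pMr// ltr1n.
by rewrite norm_ofR (gtr0_norm r2).
Qed.

(** The unit circle is contracted to the centre through [N] concentric circles. Ratios of [g] on
    consecutive circles lie in the right half-plane, and the phase of [g] telescopes from the
    constant [c] at the centre into a sum of their arguments, which is periodic. *)
Lemma disc_angle (g : C -> C) :
  {within @closed_disc R, continuous g} ->
  (forall z, closed_disc z -> g z != 0) ->
  exists c (gam : R -> R), [/\ continuous gam, gam 1 = gam 0 &
    forall t, g (expi (2 * pi * t)) / `|g (expi (2 * pi * t))| = c * expi (gam t)].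
Proof.
move=> gc g0.
have [d d0 dP] := continuous_ratio_near1 gc g0.
(* Consecutive radii will differ by [1 / N] with [N = k + 1], which is less than [d]. *)
have [k kd] := ltr_add_invr d0; rewrite add0r in kd.
pose N := k.+1.
pose p t : C := expi (2 * pi * t).
pose r i : C := ofR (i%:R / N%:R).
have N0 : (0 : R) < N%:R by rewrite ltr0n.
have rD i t : (i <= N)%N -> closed_disc (r i * p t).
  move=> iN; rewrite /closed_disc/= normrM norm_expi mulr1 norm_ofR (lecR _ 1).
  by rewrite ger0_norm ?divr_ge0// ler_pdivrMr// mul1r ler_nat.
pose f i t := g (r i.+1 * p t) / g (r i * p t).
have fRe i t : (i < N)%N -> 0 < RRe (f i t).
  move=> iN; apply: dP; [exact/rD/ltnW|exact: rD|].
  rewrite -mulrBl normrM norm_expi mulr1 distrC /r -rmorphB [`|_|]norm_ofR.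
  by rewrite -mulrBl -natrB// subSnn gtr0_norm ?divr_gt0// (ltcR _ d) div1r.
pose gam t := \sum_(i < N) right_arg (f i t).
pose c := g 0 / `|g 0|.
exists c, gam; split.
- move=> t; apply: cvg_sumr => i _.
  apply: (@cvg_comp R C R (f i) right_arg (nbhs t) (nbhs (f i t))); last first.
    by apply: continuous_right_arg; exact: fRe.
  have gr j : (j <= N)%N -> (fun t => g (r j * p t)) @ nbhs t --> g (r j * p t).
    move=> jN; apply: (within_continuous_cvg gc); first exact: rD.
      apply: cvgM; first exact: cvg_cst.
      apply: (@cvg_comp R R C (fun t => 2 * pi * t) (@expi R) (nbhs t)
        (nbhs (2 * pi * t))); last exact: continuous_expi.
      by apply: cvgM; [exact: cvg_cst|exact: cvg_id].
    by apply: nearW => t'; exact: rD.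
  apply: (@cvgM C R (nbhs t) _ (fun t => g (r i.+1 * p t))
    (fun t => (g (r i * p t))^-1)); first exact: gr.
  apply: (@cvgV C R (nbhs t) _ (fun t => g (r i * p t))); last exact/gr/ltnW.
  exact/g0/rD/ltnW.
- rewrite /gam; apply: eq_bigr => i _; congr right_arg; rewrite /f /p.
  by rewrite mulr1 mulr0 expi_2pi expi0.
- move=> t; rewrite -/(p t).
  have : forall j, (j <= N)%N -> g (r j * p t) / `|g (r j * p t)| =
      c * expi (\sum_(i < j) right_arg (f i t)).
    elim=> [_|j IH jN].
      by rewrite big_ord0 expi0 mulr1 /r mul0r mul0r.
    rewrite big_ord_recr/= expiD mulrA -IH 1?ltnW// -right_argP ?fRe//.
    have gj := g0 _ (rD j t (ltnW jN)); have gj1 := g0 _ (rD _ t jN).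
    have algE (a b a' b' : C) : a != 0 -> a' != 0 -> b' != 0 ->
        b / b' = a / a' * (b / a / (b' / a')).
      by move=> a0 a'0 b'0; field; rewrite a0 a'0 b'0.
    by rewrite /f normf_div; apply: algE; rewrite ?normr_eq0.
  move=> /(_ N (leqnn _)).
  by rewrite {1 2}/r divff ?gt_eqF// mul1r => ->.
Qed.

Lemma expi_eq1_const (f : R -> R) : {within `[0, 1], continuous f} ->
  (forall t, 0 <= t <= 1 -> expi (f t) = 1 :> C) -> f 1 = f 0.
Proof.
wlog f01 : f / f 0 <= f 1 => [H fc f1|fc f1].
  have [/H|/ltW f10] := leP (f 0) (f 1); first exact.
  apply: oppr_inj; apply: (H (fun t => - f t)); rewrite ?lerN2//.
    by move=> t; apply: cvgN; exact: fc.
  move=> t t01; have := expiD (f t) (- f t).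
  by rewrite f1// mul1r addrN expi0.
apply/eqP; rewrite eq_le f01 andbT leNgt; apply/negP => f0_lt.
(* The intermediate value [f 0 + e] is attained, but [0 < e <= pi] keeps [expi e] away from 1. *)
pose e := Num.min (f 1 - f 0) pi.
have e0 : 0 < e by rewrite lt_min subr_gt0 f0_lt pi_gt0.
have [//|t t01 ft] := @IVT R f 0 1 (f 0 + e) ler01 fc _.
  rewrite min_l// max_r// lerDl ltW//= -lerBrDl.
  by rewrite ge_min lexx.
have := f1 t; rewrite ft expiD f1 ?lexx ?ler01// mul1r => h.
have : expi e = 1 :> C by apply: h; rewrite in_itv in t01.
move/(expi_eq1); rewrite ltW//= ge_min lexx orbT => /(_ isT) e00.
by rewrite e00 ltxx in e0.
Qed.

End WindingOnDisc.

(** * Roots of unity and descent along the branched covering *)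

Section RootsOfUnity.
Context {R : realType}.
Local Notation C := (Cx R).

Definition zroot (m : nat) : C := expi (2 * pi / m%:R).

Lemma zrootX (m r : nat) : zroot m ^+ r = expi (2 * pi * r%:R / m%:R).
Proof. by rewrite /zroot -expiMn -[_ *+ r]mulr_natr mulrAC. Qed.

Lemma expi_neq1 (a : R) : 0 < a < 2 * pi -> expi a != 1 :> C.
Proof.
move=> /andP[a0 a2]; apply/eqP => a1.
have [api|api] := leP a pi.
  by have := expi_eq1 _ a1; rewrite ltW// => /(_ api) e; rewrite e ltxx in a0.
have e1 : expi (2 * pi - a) = 1 :> C.
  by have := expiD (2 * pi - a) a; rewrite subrK expi_2pi a1 mulr1.
have : 0 <= 2 * pi - a <= pi by apply/andP; split; lra.
by move=> /expi_eq1/(_ e1)/eqP; rewrite subr_eq0 => /eqP e; rewrite e ltxx in a2.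
Qed.

Lemma zroot_prim (m : nat) : (0 < m)%N -> m.-primitive_root (zroot m).
Proof.
move=> m0; rewrite /primitive_root_of_unity m0; apply/forallP => /= i.
rewrite unity_rootE zrootX.
have mR : (0 : R) < m%:R by rewrite ltr0n.
have [->|im] := eqVneq i.+1 m.
  have -> : 2 * pi * m%:R / m%:R = 2 * pi :> R by rewrite mulfK// gt_eqF.
  by rewrite expi_2pi eqxx.
rewrite (negbTE (expi_neq1 _))// divr_gt0 ?mulr_gt0 ?pi_gt0//=.
rewrite ltr_pdivrMr// ltr_pM2l ?mulr_gt0 ?pi_gt0// ltr_nat.
by rewrite ltn_neqAle im ltn_ord.
Qed.

Lemma zroot_expr (m : nat) : (0 < m)%N -> zroot m ^+ m = 1.
Proof. by move=> /zroot_prim/prim_expr_order. Qed.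

Lemma norm_zroot m : `|zroot m| = 1.
Proof. exact: norm_expi. Qed.

Lemma zroot_neq0 m : zroot m != 0.
Proof. exact: expi_neq0. Qed.

Lemma subXn_prod (m : nat) (x y : C) : (0 < m)%N ->
  x ^+ m - y ^+ m = \prod_(0 <= k < m) (x - zroot m ^+ k * y).
Proof.
move=> m0; have [->|y0] := eqVneq y 0.
  rewrite expr0n gtn_eqF//= subr0; under eq_bigr do rewrite mulr0 subr0.
  by rewrite prodr_const_nat subn0.
have h : (x / y) ^+ m - 1 = \prod_(0 <= k < m) (x / y - zroot m ^+ k).
  transitivity (('X^m - 1 : {poly C}).[x / y]); first by rewrite !hornerE.
  rewrite -(factor_Xn_sub_1 (zroot_prim m0)) horner_prod.
  by apply: eq_bigr => k _; rewrite !hornerE.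
have -> : x ^+ m - y ^+ m = y ^+ m * ((x / y) ^+ m - 1).
  by rewrite mulrBr mulr1 -exprMn mulrC divfK.
rewrite h.
under [RHS]eq_bigr => k _.
  have -> : x - zroot m ^+ k * y = y * (x / y - zroot m ^+ k).
    by rewrite mulrBr [y * (x / y)]mulrC divfK// [y * _]mulrC.
over.
by rewrite big_split/= prodr_const_nat subn0.
Qed.

(** The smallest of the [m] factors of [x^m - y^m] has its [m]-th power bounded by their product. Up
    to rotation, this makes [m]-th roots continuous, even at 0. *)
Lemma zroot_close (m : nat) (x y : C) : (0 < m)%N ->
  exists k : nat, `|x - zroot m ^+ k * y| ^+ m <= `|x ^+ m - y ^+ m|.
Proof.
move=> m0; rewrite subXn_prod// normr_prod.
pose f (k : nat) : C := `|x - zroot m ^+ k * y|.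
have freal (k : 'I_m) : f k \is Num.real by exact: normr_real.
have [k kP] : exists k : 'I_m, forall k' : 'I_m, f k <= f k'.
  pose i0 := Ordinal m0.
  (* The order on complex numbers is partial, so the minimum of the moduli is taken among their real
     parts. *)
  pose g (k : 'I_m) : R := complex.Re (f k).
  have gf (k : 'I_m) : f k = ofR (g k) by rewrite /ofR RRe_real.
  exists [arg min_(i < i0) g i]%O.
  by case: arg_minP => // i _ H k'; rewrite !gf lecR H.
exists k; rewrite -[X in _ ^+ X]subn0 -prodr_const_nat !big_mkord.
by apply: ler_prod => i _; rewrite normr_ge0 kP.
Qed.

Lemma eq_expr_zroot (m : nat) (x y : C) : (0 < m)%N -> x ^+ m = y ^+ m ->
  exists k, x = zroot m ^+ k * y.
Proof.
move=> m0 xy; have [k] := zroot_close x y m0.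
rewrite xy subrr normr0 => h; exists k.
have : `|x - zroot m ^+ k * y| ^+ m == 0 by rewrite eq_le h exprn_ge0.
by rewrite expf_eq0 m0 normr_eq0 subr_eq0 => /eqP.
Qed.

(** The units of the frame are built upstairs in a uniformizing disc, whereas trivializations of the
    desingularization live over the disc itself. [L] evaluates [W] at any chosen preimage; it is
    continuous because close values have close preimages after a rotation, by [zroot_close]. *)
Lemma power_descent (Y : topologicalType) (x : C) (m : nat) (dom : set C)
    (W : C -> Y) : (0 < m)%N ->
  (forall z, dom z -> dom (zroot m * z)) ->
  (forall z, dom z -> W (zroot m * z) = W z) ->
  {within dom, continuous W} ->
  exists2 L : C -> Y, forall z, dom z -> L (x + z ^+ m) = W z &
    {within [set x + z ^+ m | z in dom], continuous L}.
Proof.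
move=> m0 domI WI Wc.
have domX k z : dom z -> dom (zroot m ^+ k * z).
  by move=> zd; elim: k => [|k IH]; rewrite ?mul1r// exprS -mulrA; exact: domI.
have WX k z : dom z -> W (zroot m ^+ k * z) = W z.
  move=> zd; elim: k => [|k IH]; rewrite ?mul1r// exprS -mulrA WI//; exact: domX.
pose L q := W (xget 0 [set z | dom z /\ x + z ^+ m = q]).
have LE z : dom z -> L (x + z ^+ m) = W z.
  move=> zd; rewrite /L; case: xgetP => [z' _ [z'd /addrI zz']|/(_ z)[]//].
  by have [k ->] := eq_expr_zroot m0 zz'; rewrite WX.
exists L => //; apply/subspace_continuousP => _ [z zd <-].
have /subspace_continuousP/(_ z zd) Wz := Wc.
have Lz := LE z zd.
suff : L @ within [set x + z ^+ m | z in dom] (nbhs (x + z ^+ m : C)) --> W z.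
  by rewrite -Lz.
move=> A WA.
have : nbhs (z : C) [set z' | dom z' -> A (W z')] by exact: (Wz _ WA).
move=> /(@nbhs_ballP C C)[e e0 eA].
suff : nbhs (x + z ^+ m : C) [set q | [set x + z ^+ m | z in dom] q -> A (L q)] by [].
apply/(@nbhs_ballP C C); exists (e ^+ m); first exact: exprn_gt0.
move=> q qe [z' z'd zq]; move: qe; rewrite -zq LE// => qe.
have [k kP] := zroot_close z z' m0.
rewrite -(WX k)//; apply: eA; last exact: domX.
have e1 : 0 <= e by exact: ltW.
suff : `|z - zroot m ^+ k * z'| ^+ m < e ^+ m by rewrite ltr_pXn2r ?nnegrE// -lt0n.
apply: le_lt_trans kP _; move: qe; rewrite /ball/=.
by rewrite opprD addrACA subrr add0r.
Qed.

End RootsOfUnity.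

Section Phase.
Context {R : realType}.
Local Notation C := (Cx R).

Definition phase (z : C) : C := z / `|z|.

Lemma phaseM x y : phase (x * y) = phase x * phase y.
Proof. by rewrite /phase normrM invfM mulrACA. Qed.

Lemma phase1 : phase 1 = 1.
Proof. by rewrite /phase normr1 divr1. Qed.

Lemma phaseX x a : phase (x ^+ a) = phase x ^+ a.
Proof. by rewrite /phase normrX expr_div_n. Qed.

Lemma phase_prod (I : finType) (F : I -> C) :
  phase (\prod_i F i) = \prod_i phase (F i).
Proof. exact: (big_morph phase phaseM phase1). Qed.

Lemma phase_expi a : phase (expi a) = expi a.
Proof. by rewrite /phase norm_expi divr1. Qed.

(** Squaring removes the sign of a real determinant, hence the dependence on the choice of a real
    basis. *)
Lemma phase_ofR_sqr (s : R) : s != 0 -> phase (ofR s) ^+ 2 = 1.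
Proof.
move=> s0; rewrite /phase norm_ofR expr_div_n /ofR -!rmorphXn real_normK ?num_real//.
by rewrite divff// rmorphXn expf_neq0// eq_complex /= negb_and s0.
Qed.

Lemma phaseV_sqr z : z ^+ 2 / `|z| ^+ 2 = phase z ^+ 2.
Proof. by rewrite /phase expr_div_n. Qed.

Lemma expi_sum (I : finType) (F : I -> R) :
  expi (\sum_i F i) = \prod_i expi (F i) :> C.
Proof. exact: (big_morph (@expi R) expiD expi0). Qed.

Lemma Re_one_sub_gt0 (z : C) : `|z| < 1 -> 0 < complex.Re (1 - z).
Proof.
move=> z1; have := le_lt_trans (norm_Re_le z) z1; rewrite (ltcR _ 1) ltr_norml.
by move=> /andP[_ h]; rewrite raddfB /= subr_gt0.
Qed.

(** Factor out [expi a]: for [|z| < 1] the cofactor [1 - z / expi a] stays in the right half-plane,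
    so only [a] itself can wind. *)
Lemma phase_sub (a : R) (z : C) : `|z| < 1 ->
  phase (expi a - z) = expi (a + right_arg (1 - z / expi a)).
Proof.
move=> z1; rewrite expiD -right_argP; last first.
  by apply: Re_one_sub_gt0; rewrite normf_div norm_expi divr1.
rewrite -[X in X * _]phase_expi -/(phase _) -phaseM mulrBr mulr1.
by rewrite mulrCA divff ?mulr1// expi_neq0.
Qed.

Lemma continuous_angle (z : C) : `|z| < 1 ->
  continuous (fun t : R => 2 * pi * t + right_arg (1 - z / expi (2 * pi * t))).
Proof.
move=> z1 t.
have L : (fun t : R => 2 * pi * t) @ nbhs t --> 2 * pi * t.
  by apply: cvgM; [exact: cvg_cst|exact: cvg_id].
have Le : (fun t => expi (2 * pi * t) : C) @ nbhs t --> (expi (2 * pi * t) : C).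
  exact: (@cvg_comp R R C (fun t => 2 * pi * t) (@expi R) (nbhs t)
    (nbhs (2 * pi * t)) _ L (@continuous_expi R _)).
apply: cvgD; first exact: L.
apply: (@cvg_comp R C R (fun t => 1 - z / expi (2 * pi * t)) right_arg (nbhs t)
    (nbhs (1 - z / expi (2 * pi * t)))); last first.
  apply: continuous_right_arg; apply: Re_one_sub_gt0.
  by rewrite normf_div norm_expi divr1.
apply: cvgB; first exact: cvg_cst.
apply: cvgM; first exact: cvg_cst.
by apply: (@cvgV C R (nbhs t) _ (fun t => expi (2 * pi * t))); [exact: expi_neq0|].
Qed.

(* Two real bases of the same totally real subspace, one of them transported by
   [G], differ by an invertible real matrix. *)
Lemma real_basis_det (n : nat) (A0 A1 G : 'M[C]_n) (F : set 'rV[C]_n) :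
  A0 \in unitmx -> G \in unitmx -> real_basis A0 F ->
  real_basis A1 [set v | F (v *m G)] ->
  exists2 s : R, s != 0 & \det A1 * \det G = ofR s * \det A0.
Proof.
move=> uA uG [FE _] [FE1 _].
have toC_delta (X : 'M[C]_n) l : map_mx (@ofR R) (delta_mx 0 l) *m X = row l X.
  have -> : map_mx (@ofR R) (delta_mx 0 l) = delta_mx 0 l :> 'rV[C]_n.
    by apply/rowP => j; rewrite !mxE; exact: (rmorph_nat (real_complex R)).
  by rewrite rowE.
have /choice[S1 S1P] : forall l, exists r : 'rV[R]_n, map_mx (@ofR R) r *m A0 = row l (A1 *m G).
  move=> l; have : [set v | F (v *m G)] (row l A1).
    by rewrite FE1; exists (delta_mx 0 l).
  by rewrite /= FE -row_mul => -[r _ rE]; exists r.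
have /choice[S2 S2P] : forall l, exists r : 'rV[R]_n,
    map_mx (@ofR R) r *m A1 *m G = row l A0.
  move=> l; have : [set v | F (v *m G)] (row l A0 *m invmx G).
    by rewrite /= mulmxKV// FE; exists (delta_mx 0 l).
  by rewrite FE1 => -[r _ rE]; exists r; rewrite rE mulmxKV.
pose S : 'M[R]_n := \matrix_l S1 l; pose S' : 'M[R]_n := \matrix_l S2 l.
have SE : map_mx (@ofR R) S *m A0 = A1 *m G.
  by apply/row_matrixP => l; rewrite row_mul -map_row rowK S1P.
have S'E : map_mx (@ofR R) S' *m A1 *m G = A0.
  by apply/row_matrixP => l; rewrite !row_mul -map_row rowK S2P.
have detC (X : 'M[R]_n) : \det (map_mx (@ofR R) X) = ofR (\det X).
  exact: (det_map_mx (real_complex R)).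
exists (\det S); last by rewrite -detC -!det_mulmx SE.
(* Going from [A0] to the other basis and back shows that [det S' * det S] is 1. *)
have := S'E; rewrite -mulmxA -SE mulmxA => /(congr1 determinant).
rewrite !det_mulmx !detC -[RHS]mul1r => /mulIf.
rewrite unitmxE unitfE in uA => /(_ uA) h.
by apply/eqP => d0; move/eqP: h; rewrite d0 mulr0 eq_sym oner_eq0.
Qed.

End Phase.

(** * Uniformizing charts *)

Section Charts.
Context {R : realType} {n m : nat} (P : labeled_polytope R n m).
Local Notation C := (Cx R).

Lemma pairingDZ (u d : 'rV[R]_n) (e : R) b :
  pairing (u + e *: d) b = pairing u b + e * pairing d b.
Proof.
rewrite /pairing mulr_sumr -big_split/=; apply: eq_bigr => i _.
by rewrite !mxE mulrDl mulrA.
Qed.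

Definition chart_mx (F : fieldType) (s : 'I_n -> 'I_m) : 'M[F]_n :=
  \matrix_(l, i) (stacky P (s l) ord0 i)%:~R.

(* A nonzero vector orthogonal to all facet normals at a vertex would be the
   direction of a segment of the polytope around that vertex. *)
Lemma chart_mx_unit (s : 'I_n -> 'I_m) : is_chart P s -> chart_mx R s \in unitmx.
Proof.
move=> [_ [u [uP uV] us]]; rewrite -unitmx_tr -row_free_unit -kermx_eq0.
apply/negPn/negP => /rowV0Pn[d /sub_kermxP dB]; apply/negP; rewrite negbK; apply/eqP.
have ds j l : s l = j -> pairing d (stacky P j) = 0.
  move=> <-; have /rowP/(_ l) := dB; rewrite !mxE => h.
  by rewrite /pairing -[RHS]h; apply: eq_bigr => i _; rewrite !mxE.
pose gap j := pairing u (stacky P j) - offset P j.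
have gap_ge0 j : 0 <= gap j by rewrite subr_ge0; exact: (uP j).
(* A displacement by at most [e] along [d] uses up no inactive inequality; the [1 +] keeps the
   denominator positive when [d] is orthogonal to the normal. *)
pose e := \big[Order.min/1]_(a < m | 0 < gap a)
  (gap a / (1 + `|pairing d (stacky P a)|)).
have p1 j : 0 < 1 + `|pairing d (stacky P j)| by rewrite ltr_pwDl.
have e0 : 0 < e by rewrite lt_bigmin// => j gj; rewrite divr_gt0.
have inP (c : R) : `|c| <= e -> polytope P (u + c *: d).
  move=> ce j; rewrite pairingDZ -lerBlDl.
  have [gj|gj0] : 0 < gap j \/ gap j = 0.
  - by have := gap_ge0 j; rewrite le_eqVlt => /orP[/eqP|]; auto.
  - have ej : e <= gap j / (1 + `|pairing d (stacky P j)|) by exact: bigmin_le_cond.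
    rewrite -opprB lerNl -mulNr; apply: le_trans (ler_norm _) _.
    rewrite normrM normrN; apply: le_trans (_ : _ <= e * (1 + `|pairing d (stacky P j)|)) _.
      by rewrite ler_pM// lerDr.
    by rewrite -ler_pdivlMr.
  have /us[l sl] : pairing u (stacky P j) = offset P j by apply/subr0_eq.
  by rewrite (ds _ _ sl) mulr0 -opprB -/(gap j) gj0 oppr0.
have eP : `|e| <= e by rewrite gtr0_norm.
have eN : `|- e| <= e by rewrite normrN gtr0_norm.
have h12 : (0 < 1 / 2 :> R) && (1 / 2 < 1 :> R).
  by rewrite divr_gt0//= ltr_pdivrMr// mul1r ltr1n.
have := uV _ _ _ (inP _ eP) (inP _ eN) h12.
have eu : u = 1 / 2 *: (u + e *: d) + (1 - 1 / 2) *: (u + - e *: d).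
  by apply/rowP => i; rewrite !mxE; field.
move=> /(_ eu)/addrI/eqP; rewrite scaleNr -subr_eq0 opprK -scalerDl scaler_eq0.
by rewrite gt_eqF ?addr_gt0//= => /eqP.
Qed.

Lemma chart_mx_unitC (s : 'I_n -> 'I_m) : is_chart P s -> chart_mx C s \in unitmx.
Proof.
move=> /chart_mx_unit; rewrite -(map_unitmx (real_complex R)).
congr (_ \in unitmx); apply/matrixP => i j; rewrite !mxE; exact: rmorph_int.
Qed.

Lemma extendE (s : 'I_n -> 'I_m) (c : C) (y : 'rV[C]_n) l : injective s ->
  extend s c y ord0 (s l) = y ord0 l.
Proof.
move=> sI; rewrite mxE; case: pickP => [k /eqP/sI -> //|/(_ l)].
by rewrite eqxx.
Qed.

Lemma extend_out (s : 'I_n -> 'I_m) (c : C) (y : 'rV[C]_n) j :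
  (forall l, s l != j) -> extend s c y ord0 j = c.
Proof. by move=> sj; rewrite mxE; case: pickP => // k; rewrite (negbTE (sj k)). Qed.

Lemma extend0E (s : 'I_n -> 'I_m) (y : 'rV[C]_n) : injective s ->
  extend s 0 y = y *m select_mx s.
Proof.
move=> sI; apply/rowP => j; have [/codomP[l ->]|js] := boolP (j \in codom s).
  by rewrite extendE// row_select_in.
rewrite row_select_out// extend_out// => l; apply: contraNneq js => <-.
exact: codom_f.
Qed.

Lemma extend_notin (s : 'I_n -> 'I_m) (c : C) (y : 'rV[C]_n) j :
  j \notin codom s -> extend s c y ord0 j = c.
Proof.
by move=> js; rewrite extend_out// => l; apply: contraNneq js => <-; exact: codom_f.
Qed.

Definition stacky_mx (F : fieldType) : 'M[F]_(m, n) :=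
  \matrix_(j, i) (stacky P j ord0 i)%:~R.

Lemma chart_mxE F s : chart_mx F s = rowsub s (stacky_mx F).
Proof. by apply/matrixP => l i; rewrite !mxE. Qed.

Lemma lie_KCP (a : 'rV[C]_m) : lie_KC P a <-> a *m stacky_mx C = 0.
Proof.
split=> [aP|/rowP aA i]; first apply/rowP => i.
  by rewrite !mxE -[RHS](aP i); apply: eq_bigr => j _; rewrite mxE.
have := aA i; rewrite !mxE => h; rewrite -[RHS]h.
by apply: eq_bigr => j _; rewrite mxE.
Qed.

Lemma big_codom (T : Type) (idx : T) (op : Monoid.com_law idx) (s : 'I_n -> 'I_m)
    (f : 'I_m -> T) : injective s ->
  \big[op/idx]_l f (s l) = \big[op/idx]_(j | j \in codom s) f j.
Proof.
move=> sI; rewrite (reindex_omap s (fun j => [pick l | s l == j])) => [|j /codomP[l ->]].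
  apply: eq_bigl => l.
  by rewrite codom_f; case: pickP => [k /eqP/sI ->|/(_ l)]; rewrite eqxx.
by case: pickP => [k /eqP/sI -> //|/(_ l)]; rewrite eqxx.
Qed.

Lemma toC_stacky (r : 'rV[R]_m) :
  map_mx (@ofR R) r *m stacky_mx C = map_mx (@ofR R) (r *m stacky_mx R).
Proof.
rewrite [RHS](map_mxM (real_complex R)); congr (_ *m _).
by apply/matrixP => i j; rewrite !mxE; exact/esym/(rmorph_int (real_complex R)).
Qed.

Lemma imag_rowE (r : 'rV[R]_m) :
  map_mx (fun x : R => (0 +i* x)%C : C) r = ('i%C : C) *: map_mx (@ofR R) r.
Proof.
apply/rowP => j; rewrite !mxE /ofR; apply/eqP; rewrite eq_complex /=.
by rewrite mul0r !mulr0 mul1r subr0 add0r !eqxx.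
Qed.

End Charts.

(** * Homogeneous coordinates along the orbi-disc *)

Section LocalSections.
Context {R : realType} {n m k : nat} {P : labeled_polytope R n m}
  {u : 'rV[R]_n} {D : orbidisc R k} (w : holo_orbidisc P u D).
Local Notation C := (Cx R).

Lemma order_at_mark i : order_at D (mark D i) = mark_order D i.
Proof.
rewrite /order_at; case: pickP => [i' /eqP/mark_inj -> //|/(_ i)].
by rewrite eqxx.
Qed.

Lemma order_at_out q : (forall i, q <> mark D i) -> order_at D q = 1%N.
Proof.
by move=> qD; rewrite /order_at; case: pickP => // i /eqP iq; case: (qD i).
Qed.

Lemma order_at_gt0 q : (0 < order_at D q)%N.
Proof.
rewrite /order_at; case: pickP => //= i _; exact: mark_order_gt0.
Qed.

Lemma markP q : (exists i, q = mark D i) \/ (forall i, q <> mark D i).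
Proof.
have [|h] := pselect (exists i, q = mark D i); [by left|right => i qi].
by apply: h; exists i.
Qed.

Lemma order_neq1 q : order_at D q <> 1%N -> exists i, q = mark D i.
Proof. by case: (markP q) => // /order_at_out ->. Qed.

Lemma closed_disc_mark i : closed_disc (mark D i).
Proof. exact/ltW/mark_interior. Qed.

Lemma unif0 x : unif D x 0 = x.
Proof. by rewrite /unif expr0n gtn_eqF ?order_at_gt0// addr0. Qed.

Lemma ho_dom0 x : closed_disc x -> ho_dom w x 0.
Proof.
by move=> Dx; rewrite /ho_dom/unif_dom/= normr0 unif0; split=> //; exact: ho_radius_gt0.
Qed.

Lemma ho_dom_disc x zeta : ho_dom w x zeta -> closed_disc (unif D x zeta).
Proof. by case. Qed.

Lemma order_neq1_center x zeta : closed_disc x -> ho_dom w x zeta ->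
  order_at D (unif D x zeta) <> 1%N -> zeta = 0.
Proof. by move=> Dx xz; have [//|z0 []] := eqVneq zeta 0; exact: ho_domP xz z0. Qed.

Lemma unif_zroot (x zeta : C) : unif D x (zroot (order_at D x) * zeta) = unif D x zeta.
Proof. by rewrite /unif exprMn zroot_expr ?mul1r// order_at_gt0. Qed.

Lemma ho_dom_zroot x zeta :
  ho_dom w x zeta -> ho_dom w x (zroot (order_at D x) * zeta).
Proof. by rewrite /ho_dom/unif_dom/= normrM norm_zroot mul1r unif_zroot. Qed.

Lemma ho_dom_near i : \forall zeta \near (0 : C), ho_dom w (mark D i) zeta.
Proof.
have r0 := ho_radius_gt0 w (closed_disc_mark i).
have d0 : 0 < 1 - `|mark D i| by rewrite subr_gt0 mark_interior.
have uc : unif D (mark D i) @ nbhs (0 : C) --> mark D i.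
  rewrite -[X in _ --> X]unif0.
  by apply: cvgD; [exact: cvg_cst|apply: cvg_expr; exact: cvg_id].
have H1 : \forall z \near (0 : C), `|mark D i - unif D (mark D i) z| < 1 - `|mark D i|.
  by move: uc => /cvgrPdist_lt; exact.
have H2 : \forall z \near (0 : C), `|0 - z| < ho_radius w (mark D i).
  exact: (@nbhsx_ballx C C).
apply: filterS2 H1 H2 => z ze; rewrite sub0r normrN => zr; split=> //.
rewrite /closed_disc/=.
have -> : unif D (mark D i) z = mark D i - (mark D i - unif D (mark D i) z) by ring.
apply: le_trans (ler_normB _ _) _.
by rewrite -lerBrDl ltW.
Qed.

Lemma cvg_unif x zeta (F : set_system C) {FF : Filter F} : F --> zeta ->
  unif D x @ F --> unif D x zeta.
Proof.
move=> Fz; apply: cvgD; first exact: cvg_cst.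
by apply: cvg_expr.
Qed.

Lemma near_nonmark (q : C) :
  \forall q' \near q, forall i, q' = mark D i -> q' = q.
Proof.
apply: (@filter_forall _ _ _ (nbhs q)) => i.
have [<-|qi] := eqVneq q (mark D i); first exact: nearW.
have d0 : 0 < `|q - mark D i| by rewrite normr_gt0 subr_eq0.
have H : \forall q' \near q, `|q - q'| < `|q - mark D i| by exact: (@nbhsx_ballx C C).
by apply: filterS H => q' /[swap] ->; rewrite ltxx.
Qed.

Local Notation Zc := (fun x zeta => extend (ho_chart w x) 1 (ho_lift w x zeta)).

Lemma homog_neq0 x zeta j : closed_disc x -> ho_dom w x zeta ->
  (forall i, unif D x zeta <> mark D i) ->
  (forall p : Cx R, closed_disc p -> (forall i, p <> mark D i) ->
     forall j : 'I_m, ~ toric_divisor P j (ho_map w p)) ->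
  Zc x zeta ord0 j != 0.
Proof.
move=> Dx xz nm hoff; apply/eqP => z0.
apply: (hoff _ (ho_dom_disc xz) nm j); exists (Zc x zeta) => //.
exact: ho_liftP.
Qed.

Lemma weight_lt x l : (weight w x l < order_at D x)%N.
Proof.
by rewrite /weight; case: pickP => [r _|_] /=; [exact: ltn_ord|exact: order_at_gt0].
Qed.

(** By [ho_hom_order] the eigenvalue is a root of unity of the right order, so the search in
    [weight] succeeds and its default 0 is not a fallback. *)
Lemma ho_homE x l : closed_disc x ->
  ho_hom w x ord0 l = zroot (order_at D x) ^+ weight w x l.
Proof.
move=> Dx; have [r gr] := prim_rootP (@zroot_prim R _ (order_at_gt0 x)) (ho_hom_order w Dx l).
rewrite /weight; case: pickP => [r' /eqP -> /=|/(_ r)/negP[]]; first by rewrite zrootX.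
by rewrite gr zrootX.
Qed.

Lemma weight_order1 x l : order_at D x = 1%N -> weight w x l = 0%N.
Proof. by move=> x1; have := weight_lt x l; rewrite x1 ltnS leqn0 => /eqP. Qed.

Lemma trans_neq0 x y zeta eta j : closed_disc x -> closed_disc y ->
  ho_overlap w x y (zeta, eta) -> ho_trans w x y zeta eta ord0 j != 0.
Proof. by move=> Dx Dy /(ho_transP Dx Dy)[[]]. Qed.

Lemma homog_trans x y zeta eta j : closed_disc x -> closed_disc y ->
  ho_overlap w x y (zeta, eta) ->
  Zc y eta ord0 j = ho_trans w x y zeta eta ord0 j * Zc x zeta ord0 j.
Proof. by move=> Dx Dy /(ho_transP Dx Dy)[_ ->]; rewrite mxE. Qed.

End LocalSections.

Section HomogeneousCoordinates.
Context {R : realType} {n m k : nat} {P : labeled_polytope R n m}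
  {u : 'rV[R]_n} {D : orbidisc R k} (w : holo_orbidisc P u D).
Local Notation C := (Cx R).
Local Notation Zc := (fun x zeta => extend (ho_chart w x) 1 (ho_lift w x zeta)).
Variables (mult : 'I_k -> 'I_m -> nat) (h : 'I_k -> 'I_m -> C -> C).
Hypothesis h_cont : forall i j, h i j @ nbhs (0 : C) --> h i j 0.
Hypothesis h_neq0 : forall i j, h i j 0 != 0.
Hypothesis hE : forall i j, \forall zeta \near (0 : C),
  Zc (mark D i) zeta ord0 j = zeta ^+ mult i j * h i j zeta.
Hypothesis hoff : forall p : C, closed_disc p -> (forall i, p <> mark D i) ->
  forall j : 'I_m, ~ toric_divisor P j (ho_map w p).

Lemma chart_inj x : closed_disc x -> injective (ho_chart w x).
Proof. by move=> /(ho_chartP w)[]. Qed.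

Lemma mult_out i j : (forall l, ho_chart w (mark D i) l != j) -> mult i j = 0%N.
Proof.
move=> sj; have /nbhs_singleton := hE i j; rewrite extend_out// expr0n.
by case: (mult i j) => // a /=; rewrite mul0r => /eqP; rewrite oner_eq0.
Qed.

(** Let [e] be the primitive root. Equivariance of the lift gives [e^a h(e z) = e^r h(z)] after
    division by [z^a] on a punctured neighbourhood; letting [z] tend to 0 and cancelling [h(0)]
    leaves [e^a = e^r]. *)
Lemma mult_weight i l : mult i (ho_chart w (mark D i) l) =
  weight w (mark D i) l %[mod mark_order D i].
Proof.
set x := mark D i; set j := ho_chart w x l; set e := zroot (order_at D x) : C.
have Dx : closed_disc x by exact: closed_disc_mark.
pose a := mult i j; pose r := weight w x l.
suff /eqP : e ^+ a = e ^+ r.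
  by rewrite (eq_prim_root_expr (zroot_prim (order_at_gt0 x))) order_at_mark => /eqP.
apply: (mulIf (h_neq0 i j)).
have ec : (fun z : C => e * z) @ nbhs (0 : C) --> (0 : C).
  by rewrite -[X in _ --> X](mulr0 e); apply: cvgM; [exact: cvg_cst|exact: cvg_id].
have F0 : (0 : C)^' --> (0 : C) by exact: cvg_within.
have L1 : (fun z => e ^+ a * h i j (e * z)) @ (0 : C)^' --> e ^+ a * h i j 0.
  apply: cvgM; first exact: cvg_cst.
  apply: (@cvg_comp C C C (fun z => e * z) (h i j) (0 : C)^' (nbhs (0 : C))).
    by move=> A /ec; exact: F0.
  exact: h_cont.
have L2 : (fun z => e ^+ a * h i j (e * z)) @ (0 : C)^' --> e ^+ r * h i j 0.
  have L3 : (fun z => e ^+ r * h i j z) @ (0 : C)^' --> e ^+ r * h i j 0.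
    apply: cvgM; first exact: cvg_cst.
    by move=> A /(h_cont (i := i) (j := j)); exact: F0.
  apply: cvg_trans L3; apply: near_eq_cvg.
  have Hd : \forall z \near (0 : C), ho_dom w x z by exact: ho_dom_near.
  have He : \forall z \near (0 : C),
      Zc x (e * z) ord0 j = (e * z) ^+ a * h i j (e * z) by exact: (ec _ (hE i j)).
  have : \forall z \near (0 : C), z != 0 -> e ^+ r * h i j z = e ^+ a * h i j (e * z).
    apply: (@filterS3 C (nbhs (0 : C)) _ _ _ _ _ _ Hd (hE i j) He) => z zd zE ezE z0.
    have za : z ^+ a != 0 by rewrite expf_neq0.
    apply: (mulfI za); rewrite mulrCA -zE [RHS]mulrA -exprMn [z * e]mulrC -ezE.
    rewrite !extendE; try exact: chart_inj.
    by rewrite (ho_equivariant (h := w) Dx zd) mxE ho_homE.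
  by [].
exact: (cvg_unique (@norm_hausdorff C C) L1 L2).
Qed.

Definition floor_mult i j := (mult i j %/ mark_order D i)%N.
Local Notation f := floor_mult.

Lemma floor_mult_out i j : (forall l, ho_chart w (mark D i) l != j) -> f i j = 0%N.
Proof. by move=> /mult_out; rewrite /floor_mult => ->; rewrite div0n. Qed.

(** The weight is smaller than the order, hence is the remainder of the multiplicity. This is
    exactly the power absorbed by the desingularization. *)
Lemma mult_floor i l (j := ho_chart w (mark D i) l) :
  mult i j = (f i j * order_at D (mark D i) + weight w (mark D i) l)%N.
Proof.
rewrite order_at_mark {1}(divn_eq (mult i j) (mark_order D i)); congr addn.
rewrite mult_weight modn_small// -order_at_mark; exact: weight_lt.
Qed.

Definition vanish_poly j : {poly C} := \prod_i ('X - (mark D i)%:P) ^+ f i j.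
Definition vanish_other i j (q : C) : C :=
  \prod_(i' | i' != i) (q - mark D i') ^+ f i' j.

Lemma vanish_polyE j (q : C) : (vanish_poly j).[q] = \prod_i (q - mark D i) ^+ f i j.
Proof.
by rewrite horner_prod; apply: eq_bigr => i _; rewrite horner_exp !hornerE.
Qed.

Lemma vanish_polyD i j (q : C) :
  (vanish_poly j).[q] = (q - mark D i) ^+ f i j * vanish_other i j q.
Proof. by rewrite vanish_polyE (bigD1 i). Qed.

Lemma vanish_other_neq0 i j : vanish_other i j (mark D i) != 0.
Proof.
apply/prodf_neq0 => i' i'i; rewrite expf_neq0// subr_eq0.
by apply: contraNneq i'i => /mark_inj ->.
Qed.

Lemma vanish_poly_neq0 j (q : C) : (forall i, q <> mark D i) -> (vanish_poly j).[q] != 0.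
Proof.
move=> qD; rewrite vanish_polyE; apply/prodf_neq0 => i _.
by rewrite expf_neq0// subr_eq0; apply/eqP.
Qed.

Lemma cvg_vanish_other i j T (g : T -> C) (G : set_system T) {FG : Filter G} (q : C) :
  g @ G --> q -> vanish_other i j (g x) @[x --> G] --> vanish_other i j q.
Proof.
move=> gq; apply: cvg_prodr => i' _; apply: cvg_expr.
by apply: cvgB; [exact: gq|exact: cvg_cst].
Qed.

(** For a facet of the chart, the limit at the mark of the homogeneous coordinate divided by
    [vanish_poly j] and by [zeta^weight]: by [mult_floor] all powers of [zeta] cancel. *)
Definition lead_value i j : C := h i j 0 / vanish_other i j (mark D i).

Lemma lead_value_neq0 i j : lead_value i j != 0.
Proof. by rewrite mulf_neq0 ?invr_neq0 ?vanish_other_neq0. Qed.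

(* The homogeneous coordinate [j] of the lift divided by [vanish_poly j]; at a
   smooth marked point the quotient is extended through the transition from the
   lift centred there. *)
Definition sigma x j zeta : C :=
  if [pick i | mark D i == unif D x zeta] is Some i
  then ho_trans w (mark D i) x 0 zeta ord0 j * lead_value i j
  else Zc x zeta ord0 j / (vanish_poly j).[unif D x zeta].

Lemma sigma_mark x j zeta i : unif D x zeta = mark D i ->
  sigma x j zeta = ho_trans w (mark D i) x 0 zeta ord0 j * lead_value i j.
Proof.
by rewrite /sigma => ->; case: pickP => [i' /eqP/mark_inj -> //|/(_ i)]; rewrite eqxx.
Qed.

Lemma sigma_nonmark x j zeta : (forall i, unif D x zeta <> mark D i) ->
  sigma x j zeta = Zc x zeta ord0 j / (vanish_poly j).[unif D x zeta].
Proof. by rewrite /sigma => xD; case: pickP => // i /eqP/esym/xD. Qed.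

Lemma overlap_mark x zeta i : closed_disc x -> ho_dom w x zeta ->
  order_at D (unif D x zeta) = 1%N -> unif D x zeta = mark D i ->
  ho_overlap w (mark D i) x (0, zeta).
Proof.
move=> Dx xz o1 e; split => //=; rewrite ?unif0//; first exact/ho_dom0/closed_disc_mark.
by rewrite -e.
Qed.

Lemma floor_mult1 i j : order_at D (mark D i) = 1%N -> f i j = mult i j.
Proof. by rewrite order_at_mark /floor_mult => ->; rewrite divn1. Qed.

Lemma sigmaE x j zeta : closed_disc x -> ho_dom w x zeta ->
  order_at D (unif D x zeta) = 1%N ->
  Zc x zeta ord0 j = (vanish_poly j).[unif D x zeta] * sigma x j zeta.
Proof.
move=> Dx xz o1; have [[i xi]|xD] := markP (D := D) (unif D x zeta); last first.
  by rewrite sigma_nonmark// mulrC divfK// vanish_poly_neq0.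
have ov := overlap_mark Dx xz o1 xi.
rewrite (homog_trans j (closed_disc_mark i) Dx ov) (sigma_mark _ xi).
(* At the mark both sides carry the same power of 0, which is 1 when the multiplicity is 0. *)
have /nbhs_singleton -> := hE i j.
have fi : f i j = mult i j by apply: floor_mult1; rewrite -xi.
rewrite xi (vanish_polyD i) subrr fi /lead_value.
by field; exact: vanish_other_neq0.
Qed.

Lemma sigma_neq0 x j zeta : closed_disc x -> ho_dom w x zeta ->
  order_at D (unif D x zeta) = 1%N -> sigma x j zeta != 0.
Proof.
move=> Dx xz o1; have [[i xi]|xD] := markP (D := D) (unif D x zeta); last first.
  rewrite sigma_nonmark// mulf_neq0 ?invr_neq0 ?vanish_poly_neq0//.
  exact: homog_neq0.
rewrite (sigma_mark _ xi) mulf_neq0 ?lead_value_neq0//.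
exact/(trans_neq0 j (closed_disc_mark i) Dx)/overlap_mark.
Qed.

(** [vanish_poly j] depends only on the point of the disc, so [sigma] inherits the transition law of
    the homogeneous coordinate; at a smooth mark the law is the cocycle condition. *)
Lemma sigma_trans x y j zeta eta : closed_disc x -> closed_disc y ->
  ho_overlap w x y (zeta, eta) ->
  sigma y j eta = ho_trans w x y zeta eta ord0 j * sigma x j zeta.
Proof.
move=> Dx Dy ov; have [/= xz yz xy o1] := ov.
have [[i xi]|xD] := markP (D := D) (unif D x zeta); last first.
  rewrite !sigma_nonmark -?xy// (homog_trans j Dx Dy ov).
  by rewrite mulrA.
have ovx := overlap_mark Dx xz o1 xi.
rewrite (sigma_mark _ xi) (@sigma_mark y j eta i) -?xy//.
by rewrite (ho_trans_cocycle (h := w) (closed_disc_mark i) Dx Dy ovx ov) mxE mulrA.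
Qed.

Lemma cvg_homog x j zeta : closed_disc x -> ho_dom w x zeta ->
  (fun z => Zc x z ord0 j) @ within (ho_dom w x) (nbhs (zeta : C)) --> Zc x zeta ord0 j.
Proof.
move=> Dx xz.
have /subspace_continuousP/(_ _ xz) yc := ho_lift_continuous (h := w) Dx.
rewrite mxE; under eq_cvg do rewrite mxE.
by case: pickP => [l _|_]; [exact: (@cvg_coord _ _ _ _ _ (ho_lift w x) _ ord0 l yc)|exact: cvg_cst].
Qed.

Lemma cvg_sigma x j zeta : closed_disc x -> ho_dom w x zeta ->
  order_at D (unif D x zeta) = 1%N ->
  sigma x j @ within (ho_dom w x) (nbhs (zeta : C)) --> sigma x j zeta.
Proof.
move=> Dx xz o1; set F := within _ _.
have Fid : id @ F --> (zeta : C) by exact: cvg_within.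
have uF : unif D x @ F --> unif D x zeta by exact: cvg_unif.
have Fdom : \forall z \near F, ho_dom w x z.
  by rewrite near_withinE; exact: nearW.
have nearm : \forall z \near F, forall i, unif D x z = mark D i ->
    unif D x z = unif D x zeta by exact: (uF _ (near_nonmark (unif D x zeta))).
have [[i xi]|xD] := markP (D := D) (unif D x zeta); last first.
  have Fnm : \forall z \near F, forall i, unif D x z <> mark D i.
    by apply: filterS nearm => z H i zi; apply: (xD i); rewrite -zi (H i zi).
  rewrite (sigma_nonmark _ xD).
  have L : (fun z => Zc x z ord0 j / (vanish_poly j).[unif D x z]) @ F -->
      Zc x zeta ord0 j / (vanish_poly j).[unif D x zeta].
    apply: cvgM; first exact: cvg_homog.
    by apply: cvgV; [exact: vanish_poly_neq0|exact: cvg_horner].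
  apply: cvg_trans L; apply: near_eq_cvg.
  by apply: filterS Fnm => z zD; rewrite sigma_nonmark.
have Di : closed_disc (mark D i) by exact: closed_disc_mark.
have oi : order_at D (mark D i) = 1%N by rewrite -xi.
(* At a mark of order 1 the uniformizing map is a translation, and [eta z] is the point over
   [unif D x z]. *)
pose eta z := unif D x z - mark D i.
have eta0 : eta zeta = 0 by rewrite /eta xi subrr.
have etac : eta @ F --> (0 : C).
  by rewrite -eta0; apply: cvgB; [exact: uF|exact: cvg_cst].
have unif_eta z : unif D (mark D i) (eta z) = unif D x z.
  by rewrite /unif oi expr1 /eta addrC subrK.
have Feta : \forall z \near F, ho_dom w (mark D i) (eta z).
  by move: etac => /(_ _ (ho_dom_near w i)).
have Fov : \forall z \near F, ho_overlap w (mark D i) x (eta z, z).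
  apply: filterS2 (filterI Feta Fdom) nearm => z [ze zd] zm.
  split; [exact: ze|exact: zd|exact: unif_eta|].
  rewrite [unif _ _ _]unif_eta; have [[i' zi']|zD] := markP (D := D) (unif D x z).
    by rewrite (zm _ zi').
  exact: order_at_out.
(* One formula for [sigma] valid both at the mark and around it: the factor [(q - z_i)^mult] has
   been cancelled. *)
pose g z := ho_trans w (mark D i) x (eta z) z ord0 j *
  (h i j (eta z) / vanish_other i j (unif D x z)).
have gc : g @ F --> sigma x j zeta.
  rewrite (sigma_mark _ xi) /lead_value.
  apply: cvgM.
    apply: (@cvg_coord _ _ _ _ _ (fun z => ho_trans w (mark D i) x (eta z) z) _ ord0 j).
    have etap : (fun z => (eta z, z)) @ F --> ((0, zeta) : C * C).
      exact: (@cvg_pair C C C F (nbhs (0 : C)) (nbhs zeta) _ _ _ eta id etac Fid).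
    exact: (within_continuous_cvg (ho_trans_continuous (h := w) Di Dx)
      (overlap_mark Dx xz o1 xi) etap Fov).
  apply: cvgM; last first.
    apply: cvgV; first exact: vanish_other_neq0.
    by rewrite -xi; exact: cvg_vanish_other.
  exact: (@cvg_comp C C C eta (h i j) F (nbhs (0 : C)) (nbhs (h i j 0)) etac
    (h_cont (i := i) (j := j))).
apply: cvg_trans gc; apply: near_eq_cvg.
have FhE := etac _ (hE i j).
near=> z.
have ov : ho_overlap w (mark D i) x (eta z, z) by near: z.
have zE : Zc (mark D i) (eta z) ord0 j = eta z ^+ mult i j * h i j (eta z) by near: z.
have zm : forall i, unif D x z = mark D i -> unif D x z = unif D x zeta by near: z.
rewrite /g; have [[i' zi']|zD] := markP (D := D) (unif D x z).
  have zi : unif D x z = mark D i by rewrite (zm _ zi').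
  by rewrite (sigma_mark _ zi) /eta zi subrr /lead_value.
rewrite sigma_nonmark// (homog_trans j Di Dx ov) zE (vanish_polyD i) floor_mult1//.
rewrite -/(eta z) -!mulrA; congr (_ * _).
have e0 : eta z ^+ mult i j != 0.
  by rewrite expf_neq0// subr_eq0; apply/eqP/zD.
by rewrite invfM mulrCA mulVKf.
Unshelve. all: by end_near. Qed.

Lemma zeta_weight_neq0 x zeta l : closed_disc x -> ho_dom w x zeta ->
  order_at D (unif D x zeta) = 1%N -> zeta ^+ weight w x l != 0.
Proof.
move=> Dx xz o1; have [z0|z0] := eqVneq zeta 0; last exact: expf_neq0.
by rewrite weight_order1 ?expr0 ?oner_neq0// -(unif0 (D := D) x) -z0.
Qed.

(** The power of [zeta] that [resing] reintroduces is divided out of [sigma], and an orbifold centre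
    receives the limit. On the domain of a lift the default 0 is not reached: a point of order other
    than 1 is the centre, hence a mark. *)
Definition local_unit x zeta : 'rV[C]_n := \row_l
  if order_at D (unif D x zeta) == 1%N
  then sigma x (ho_chart w x l) zeta / zeta ^+ weight w x l
  else if [pick i | mark D i == x] is Some i
  then lead_value i (ho_chart w x l) else 0.

Lemma local_unit_order1 x zeta l : order_at D (unif D x zeta) = 1%N ->
  local_unit x zeta ord0 l = sigma x (ho_chart w x l) zeta / zeta ^+ weight w x l.
Proof. by move=> o1; rewrite mxE o1 eqxx. Qed.

Lemma local_unit_center i l : order_at D (mark D i) <> 1%N ->
  local_unit (mark D i) 0 ord0 l = lead_value i (ho_chart w (mark D i) l).
Proof.
move=> /eqP/negbTE o1; rewrite mxE unif0 o1.
by case: pickP => [i' /eqP/mark_inj -> //|/(_ i)]; rewrite eqxx.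
Qed.

Lemma local_unit_neq0 x zeta l : closed_disc x -> ho_dom w x zeta ->
  local_unit x zeta ord0 l != 0.
Proof.
move=> Dx xz; have [e1|/eqP o1] := eqVneq (order_at D (unif D x zeta)) 1%N.
  rewrite local_unit_order1// mulf_neq0 ?invr_neq0 ?zeta_weight_neq0//.
  exact: sigma_neq0.
have z0 := order_neq1_center Dx xz o1.
move: o1; rewrite z0 unif0 => o1; have [i xi] := order_neq1 o1.
by rewrite xi local_unit_center -?xi// lead_value_neq0.
Qed.

(** Rotation multiplies [sigma] by the entry of [ho_hom], through [ho_trans_hom], and [zeta^weight]
    by the same root of unity. *)
Lemma local_unit_zroot x zeta : closed_disc x -> ho_dom w x zeta ->
  local_unit x (zroot (order_at D x) * zeta) = local_unit x zeta.
Proof.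
move=> Dx xz; apply/rowP => l; rewrite !mxE unif_zroot; case: eqP => [e1|_]; last reflexivity.
have ov : ho_overlap w x x (zeta, zroot (order_at D x) * zeta).
  by split; [exact: xz|exact: ho_dom_zroot|exact/esym/unif_zroot|].
rewrite (sigma_trans _ Dx Dx ov) (ho_trans_hom (h := w) Dx ov erefl).
rewrite (extendE _ _ _ (chart_inj Dx)) (ho_homE _ _ Dx).
have e0 : zroot (order_at D x) ^+ weight w x l != 0 :> C by rewrite expf_neq0 ?zroot_neq0.
by rewrite exprMn invfM mulrACA (divff e0) mul1r.
Qed.

Lemma near_order1 x (zeta : C) : closed_disc x -> ho_dom w x zeta ->
  order_at D (unif D x zeta) = 1%N ->
  \forall z \near nbhs zeta, ho_dom w x z -> order_at D (unif D x z) = 1%N.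
Proof.
move=> Dx xz o1; have [z0|z0] := eqVneq zeta 0.
  apply: nearW => z xz'; have [z'0|z'0] := eqVneq z 0; first by rewrite z'0 -z0.
  exact: (ho_domP Dx xz' z'0).
have d0 : 0 < `|zeta| by rewrite normr_gt0.
have H : \forall z \near nbhs zeta, `|zeta - z| < `|zeta| by exact: (@nbhsx_ballx C C).
apply: filterS H => z zz xz'; apply: (ho_domP Dx xz').
by apply: contraTneq zz => ->; rewrite subr0 ltxx.
Qed.

Lemma cvg_local_unit x (zeta : C) : closed_disc x -> ho_dom w x zeta ->
  local_unit x @ within (ho_dom w x) (nbhs zeta) --> local_unit x zeta.
Proof.
move=> Dx xz; apply: cvg_mx => a l; rewrite (ord1 a).
set F := within _ _.
have Fid : id @ F --> zeta by exact: cvg_within.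
have [e1|/eqP o1] := eqVneq (order_at D (unif D x zeta)) 1%N.
  have L : (fun z => sigma x (ho_chart w x l) z / z ^+ weight w x l) @ F -->
      sigma x (ho_chart w x l) zeta / zeta ^+ weight w x l.
    apply: cvgM; first exact: cvg_sigma.
    by apply: cvgV; [exact: zeta_weight_neq0|exact: (@cvg_expr _ _ _ _ id zeta _ Fid)].
  rewrite [X in _ --> X](local_unit_order1 _ e1); apply: cvg_trans L; apply: near_eq_cvg.
  have H : \forall z \near F, order_at D (unif D x z) = 1%N by exact: near_order1.
  by apply: filterS H => z zo; rewrite (local_unit_order1 _ zo).
have z0 := order_neq1_center Dx xz o1.
move: o1; rewrite z0 unif0 => o1; have [i xi] := order_neq1 o1.
subst x; set x := mark D i in Dx xz F Fid z0 o1 *.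
rewrite z0 in Fid; set j := ho_chart w x l.
(* By [mult_floor] this is what remains of the coordinate near an orbifold centre. *)
pose g z := h i j z / vanish_other i j (unif D x z).
have uF : unif D x @ F --> x.
  by rewrite -[X in _ --> X](unif0 (D := D) x); exact: cvg_unif.
have gc : g @ F --> g 0.
  apply: cvgM.
    exact: (@cvg_comp C C C id (h i j) F (nbhs (0 : C)) (nbhs (h i j 0)) Fid
      (h_cont (i := i) (j := j))).
  apply: cvgV; first by rewrite unif0 vanish_other_neq0.
  by rewrite unif0; exact: cvg_vanish_other.
have Wg0 : local_unit x 0 ord0 l = g 0.
  by rewrite /g unif0 (local_unit_center _ o1).
rewrite [X in _ --> X]Wg0; apply: cvg_trans gc; apply: near_eq_cvg.
have Fdom : \forall z \near F, ho_dom w x z by rewrite near_withinE; exact: nearW.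
have FhE : \forall z \near F, Zc x z ord0 j = z ^+ mult i j * h i j z.
  by have := Fid _ (hE i j).
have nearm : \forall z \near F, forall i, unif D x z = mark D i -> unif D x z = x.
  exact: (uF _ (near_nonmark (D := D) x)).
near=> z; apply: esym.
have zd : ho_dom w x z by near: z.
have zE : Zc x z ord0 j = z ^+ mult i j * h i j z by near: z.
have zm : forall i, unif D x z = mark D i -> unif D x z = x by near: z.
have [->|zn0] := eqVneq z 0; first exact: Wg0.
have oz := ho_domP Dx zd zn0.
have xD : forall i, unif D x z <> mark D i.
  move=> i' zi; have /eqP := zm _ zi; rewrite -subr_eq0 /unif addrC addKr.
  by rewrite expf_eq0 (negbTE zn0) andbF.
rewrite (local_unit_order1 _ oz) (sigma_nonmark _ xD) [extend _ _ _ _ _]zE (vanish_polyD i) /g.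
have -> : unif D x z - x = z ^+ order_at D x by rewrite /unif addrC addKr.
have -> : mult i j = (order_at D x * f i j + weight w x l)%N.
  by rewrite /j mult_floor mulnC.
rewrite exprD exprM.
have A : (z ^+ order_at D x) ^+ f i j != 0 by rewrite !expf_neq0.
have B : z ^+ weight w x l != 0 by rewrite expf_neq0.
move: (z ^+ order_at D x ^+ f i j) (z ^+ weight w x l) A B => A B A0 B0.
rewrite invfM; move: (vanish_other _ _ _)^-1 => V.
by field; rewrite A0 B0.
Unshelve. all: by end_near. Qed.

Lemma exists_unit_descent : exists lam : C -> C -> 'rV[C]_n,
  forall x, closed_disc x ->
    {within [set unif D x zeta | zeta in ho_dom w x], continuous (lam x)} /\
    forall zeta, ho_dom w x zeta -> lam x (unif D x zeta) = local_unit x zeta.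
Proof.
suff /choice[lam lamP] : forall x, exists L : C -> 'rV[C]_n, closed_disc x ->
    {within [set unif D x zeta | zeta in ho_dom w x], continuous L} /\
    forall zeta, ho_dom w x zeta -> L (unif D x zeta) = local_unit x zeta.
  by exists lam.
move=> x; have [Dx|nDx] := pselect (closed_disc x); last by exists (fun=> 0) => /nDx.
have Wc : {within ho_dom w x, continuous (local_unit x)}.
  apply/subspace_continuousP => zeta xz; exact: cvg_local_unit.
have [L LE Lc] := power_descent x (order_at_gt0 (D := D) x) (ho_dom_zroot (w := w) (x := x))
  (fun zeta xz => local_unit_zroot Dx xz) Wc.
by exists L => _; split.
Qed.

(** * A global frame of the desingularization *)

Variables (M : 'M[{poly C}]_n) (lam : C -> C -> 'rV[C]_n).
Hypothesis M_det : \det M =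
  \prod_i \prod_l ('X - (mark D i)%:P) ^+ f i (ho_chart w (mark D i) l).
Hypothesis M_row : forall i l c,
  ('X - (mark D i)%:P) ^+ f i (ho_chart w (mark D i) l) %|
  (map_mx polyC (chart_mx P C (ho_chart w (mark D i))) *m M) l c.
Hypothesis lam_cont : forall x, closed_disc x ->
  {within [set unif D x zeta | zeta in ho_dom w x], continuous (lam x)}.
Hypothesis lamE : forall x, closed_disc x -> forall zeta, ho_dom w x zeta ->
  lam x (unif D x zeta) = local_unit x zeta.

Local Notation A := (stacky_mx P C).
Local Notation AM := (map_mx polyC A *m M).

Lemma vanish_poly_nonzero j : vanish_poly j != 0.
Proof.
by apply/prodf_neq0 => i _; rewrite expf_neq0// polyXsubC_eq0.
Qed.

(** Powers of distinct linear factors are coprime, so each may be treated alone: [M_row] covers a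
    facet in the chart of the mark, and otherwise the exponent is 0. *)
Lemma vanish_poly_dvd j c : vanish_poly j %| AM j c.
Proof.
have H : forall r : seq 'I_k, uniq r ->
    \prod_(i <- r) ('X - (mark D i)%:P) ^+ f i j %| AM j c.
  elim=> [|i r IH] /=; first by rewrite big_nil dvd1p.
  move=> /andP[ir ur]; rewrite big_cons Gauss_dvdp ?IH ?andbT//; last first.
    rewrite coprimep_expl// coprimep_sym coprimep_XsubC rootE horner_prod.
    rewrite prodf_seq_neq0; apply/allP => i' i'r /=.
    rewrite horner_exp !hornerE expf_neq0// subr_eq0.
    by apply: contraNneq ir => /mark_inj ->.
  have [/codomP[l jl]|js] := boolP (j \in codom (ho_chart w (mark D i))).
    have := M_row i l c; rewrite -jl; congr (_ %| _).
    by rewrite !mxE; apply: eq_bigr => a _; rewrite !mxE jl.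
  rewrite floor_mult_out ?dvd1p// => l; apply: contraNneq js => <-.
  exact: codom_f.
exact/H/index_enum_uniq.
Qed.

Definition quot_mx : 'M[{poly C}]_(m, n) := \matrix_(j, c) (AM j c %/ vanish_poly j).

Lemma quot_mxE : AM = diag_mx (\row_j vanish_poly j) *m quot_mx.
Proof.
apply/matrixP => j c; rewrite mul_diag_mx [RHS]mxE [X in X * _]mxE [X in _ * X]mxE.
by rewrite mulrC divpK// vanish_poly_dvd.
Qed.

Definition frame_inv (q : C) : 'M[C]_n := map_mx (horner_eval q) M.
Definition facet_row (q : C) : 'M[C]_(m, n) := map_mx (horner_eval q) quot_mx.

Lemma frame_invE q :
  A *m frame_inv q = diag_mx (\row_j (vanish_poly j).[q]) *m facet_row q.
Proof.
have -> : A *m frame_inv q = map_mx (horner_eval q) AM.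
  rewrite map_mxM; congr (_ *m _); apply/matrixP => i j.
  transitivity (map_mx polyC A i j).[q]; last by rewrite [RHS]mxE.
  by rewrite [X in X.[_]]mxE hornerC.
rewrite quot_mxE map_mxM map_diag_mx; congr (diag_mx _ *m _).
by apply/rowP => j; rewrite !mxE.
Qed.

Lemma det_vanish_poly : \det M = \prod_j vanish_poly j.
Proof.
rewrite M_det /vanish_poly.
transitivity (\prod_i \prod_j ('X - (mark D i)%:P) ^+ f i j); last exact: exchange_big.
apply: eq_bigr => i _.
rewrite (big_codom _ (fun j => ('X - (mark D i)%:P) ^+ f i j)); last first.
  exact/chart_inj/closed_disc_mark.
rewrite [RHS](bigID (mem (codom (ho_chart w (mark D i)))))/=.
rewrite [X in _ = _ * X]big1 ?mulr1// => j js.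
rewrite floor_mult_out ?expr0// => l; apply: contraNneq js => <-.
exact: codom_f.
Qed.

Lemma det_frame_inv q : \det (frame_inv q) = \prod_j (vanish_poly j).[q].
Proof. by rewrite det_map_mx det_vanish_poly /= /horner_eval horner_prod. Qed.

(** The homogeneous coordinate is constantly 1 there, and [sigmaE] exhibits the vanishing polynomial
    as a factor of it. At an orbifold centre the exponent is 0. *)
Lemma vanish_poly_notin x zeta j : closed_disc x -> ho_dom w x zeta ->
  j \notin codom (ho_chart w x) -> (vanish_poly j).[unif D x zeta] != 0.
Proof.
move=> Dx xz js; have [e1|/eqP o1] := eqVneq (order_at D (unif D x zeta)) 1%N.
  have := sigmaE j Dx xz e1; rewrite [LHS]extend_notin// => h1.
  by apply/eqP => h0; move/eqP: h1; rewrite h0 mul0r oner_eq0.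
have z0 := order_neq1_center Dx xz o1.
move: o1; rewrite z0 unif0 => o1; have [i xi] := order_neq1 o1.
rewrite (vanish_polyD i) {1}xi subrr floor_mult_out ?expr0 ?mul1r.
  by rewrite xi vanish_other_neq0.
by move=> l; rewrite -xi; apply: contraNneq js => <-; exact: codom_f.
Qed.

(** The vanishing polynomials of the chart facets are cancelled as polynomials, before evaluation.
    The selected minor of [quot_mx] is then a nonzero constant times the vanishing polynomials
    outside the chart, nonzero at the point. *)
Lemma facet_row_unit x zeta : closed_disc x -> ho_dom w x zeta ->
  rowsub (ho_chart w x) (facet_row (unif D x zeta)) \in unitmx.
Proof.
move=> Dx xz; set s := ho_chart w x; set q := unif D x zeta.
have sI : injective s by exact: chart_inj.
have E : map_mx polyC (chart_mx P C s) *m M =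
    diag_mx (\row_l vanish_poly (s l)) *m rowsub s quot_mx.
  have -> : map_mx polyC (chart_mx P C s) = rowsub s (map_mx polyC A).
    by apply/matrixP => l i; rewrite !mxE.
  rewrite -[rowsub s (map_mx _ _)]mul_select_mx -mulmxA quot_mxE mulmxA.
  have -> : select_mx s *m diag_mx (\row_j vanish_poly j) =
      diag_mx (\row_l vanish_poly (s l)) *m select_mx s.
    rewrite mul_select_mx; apply/matrixP => l j; rewrite mul_diag_mx !mxE.
    by rewrite mulr_natr.
  by rewrite -mulmxA mul_select_mx.
have /(congr1 determinant) := E.
rewrite !det_mulmx det_diag det_vanish_poly.
under [X in _ = X * _]eq_bigr do rewrite mxE.
rewrite (big_codom _ vanish_poly sI) (bigID (mem (codom s)))/= mulrCA.
move=> /mulfI H; rewrite unitmxE unitfE.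
have -> : rowsub s (facet_row q) = map_mx (horner_eval q) (rowsub s quot_mx).
  by apply/matrixP => l c; rewrite !mxE.
rewrite det_map_mx -H; last by apply/prodf_neq0 => j _; exact: vanish_poly_nonzero.
rewrite det_map_mx /= /horner_eval hornerM hornerC mulf_neq0//.
  by have := chart_mx_unitC (ho_chartP w Dx); rewrite unitmxE unitfE.
by rewrite horner_prod; apply/prodf_neq0 => j; exact: vanish_poly_notin.
Qed.

(** The inverse normalizes row [l] so that its product with the facet rows is the [l]-th unit vector
    in every chart; the factor [lam] becomes [sigma] after [resing]. *)
Definition desing_frame x q : 'M[C]_n :=
  invmx (rowsub (ho_chart w x) (facet_row q)) *m diag_mx (lam x q).

Local Notation E := (desingularization w).

Lemma desing_frame_continuous x : closed_disc x ->
  {within bp_nbhd E x, continuous (desing_frame x)}.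
Proof.
move=> Dx; apply/subspace_continuousP => q xq.
have /subspace_continuousP/(_ q xq) Lc := lam_cont Dx.
have [zeta xz zq] := xq.
have Fid : id @ within (bp_nbhd E x) (nbhs q) --> q by exact: cvg_within.
apply: cvg_mulmx.
  apply: cvg_invmx; first by rewrite -zq facet_row_unit.
  apply: cvg_mx => l c; rewrite 3!mxE.
  under eq_cvg do rewrite 3!mxE.
  exact: (@cvg_horner _ _ _ _ id).
apply: cvg_mx => i j; rewrite mxE -mulr_natr.
under eq_cvg do rewrite mxE -mulr_natr.
apply: cvgM; last exact: cvg_cst.
exact: (@cvg_coord _ _ _ _ _ (lam x) _ ord0 i Lc).
Qed.

Lemma desing_frame_unit x q : closed_disc x -> bp_nbhd E x q ->
  desing_frame x q \in unitmx.
Proof.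
move=> Dx [zeta xz <-]; rewrite unitmx_mul unitmx_inv facet_row_unit//=.
rewrite unitmxE unitfE det_diag; apply/prodf_neq0 => l _.
by rewrite lamE// local_unit_neq0.
Qed.

Lemma resing_frame x zeta (c : 'rV[C]_n) : closed_disc x -> ho_dom w x zeta ->
  order_at D (unif D x zeta) = 1%N ->
  extend (ho_chart w x) 0
    (resing w x zeta (c *m diag_mx (lam x (unif D x zeta)))) =
  \row_j (sigma x j zeta * (c *m select_mx (ho_chart w x)) ord0 j).
Proof.
move=> Dx xz o1; have sI := chart_inj Dx; rewrite (extend0E _ sI).
apply/rowP => j; rewrite [RHS]mxE.
have [/codomP[l ->]|js] := boolP (j \in codom (ho_chart w x)); last first.
  by rewrite !row_select_out// mulr0.
rewrite !row_select_in// mxE mul_mx_diag mxE (lamE Dx xz) (local_unit_order1 _ o1).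
by rewrite mulrCA [RHS]mulrC; congr (_ * _); rewrite mulrC divfK// zeta_weight_neq0.
Qed.

(** The normalized rows [ec] of the two charts have the same product with [facet_row], so by
    [lift_row_relation] they differ by [a_j * vanish_poly j] with [a] in [lie_KC]. Multiplied by
    [sigma], this is [a] times the homogeneous coordinate, the correction that [dchange] allows. *)
Lemma desing_frame_dchange x y zeta eta l : closed_disc x -> closed_disc y ->
  ho_overlap w x y (zeta, eta) ->
  dchange P (ho_chart w x) (ho_chart w y) (ho_trans w x y zeta eta) (ho_lift w y eta)
    (resing w x zeta (row l (desing_frame x (unif D x zeta))))
    (resing w y eta (row l (desing_frame y (unif D x zeta)))).
Proof.
move=> Dx Dy ov; have [/= xz yz xy o1] := ov; set q := unif D x zeta.
have sIx := chart_inj Dx; have sIy := chart_inj Dy.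
have ux : rowsub (ho_chart w x) (facet_row q) \in unitmx by exact: facet_row_unit.
have uy : rowsub (ho_chart w y) (facet_row q) \in unitmx.
  by rewrite /q xy; exact: facet_row_unit.
pose c x := row l (invmx (rowsub (ho_chart w x) (facet_row q))).
pose ec x := c x *m select_mx (ho_chart w x).
have ecN z : rowsub (ho_chart w z) (facet_row q) \in unitmx ->
    ec z *m facet_row q = row l 1%:M.
  by move=> uz; rewrite /ec -mulmxA mul_select_mx -row_mul (mulVmx uz).
have cN : (ec y - ec x) *m facet_row q = 0.
  transitivity (ec y *m facet_row q - ec x *m facet_row q); first exact: mulmxBl.
  by rewrite [X in X - _](ecN y uy) [X in _ - X](ecN x ux) subrr.
have uA : rowsub (ho_chart w x) A \in unitmx.
  by rewrite -chart_mxE; apply: chart_mx_unitC; exact: ho_chartP.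
have [a [aA aE]] := lift_row_relation (van := fun j => (vanish_poly j).[q]) sIx
  (fun j => @vanish_poly_notin x zeta j Dx xz) (frame_invE q) uA ux cN.
exists a; first exact/lie_KCP.
have oy : order_at D (unif D y eta) = 1%N by rewrite -xy.
have rE z theta : closed_disc z -> ho_dom w z theta -> unif D z theta = q ->
    extend (ho_chart w z) 0 (resing w z theta (row l (desing_frame z q))) =
    \row_j (sigma z j theta * ec z ord0 j).
  move=> Dz zt zq; rewrite row_mul -/(c z) -zq resing_frame ?zq//.
rewrite (rE x zeta Dx xz erefl) (rE y eta Dy yz (esym xy)).
apply/rowP => j; rewrite mxE [RHS]mxE [X in _ = X + _]mxE [X in _ = _ * X + _]mxE.
rewrite [X in _ = _ + X]mxE.
have {}aE : ec y ord0 j = ec x ord0 j + a ord0 j * (vanish_poly j).[q].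
  rewrite -aE; move: (ec y) (ec x) => U V.
  by rewrite [(U - V) _ _]mxE [X in _ = _ + (_ + X)]mxE addrC subrK.
rewrite [extend _ _ _ _ _](sigmaE j Dy yz oy) -xy -/q aE (sigma_trans j Dx Dy ov).
ring.
Qed.

Lemma bp_nbhd_self p : closed_disc p -> bp_nbhd E p p.
Proof. by move=> Dp; exists 0; [exact: ho_dom0|exact: unif0]. Qed.

Lemma desing_frame_global : global_frame E desing_frame.
Proof.
split=> [x|x p|x y p Dx Dy [zeta xz zp] [eta yz ep] l].
- exact: desing_frame_continuous.
- exact: desing_frame_unit.
rewrite /= /desing_same; have [e1|/eqP o1] := eqVneq (order_at D p) 1%N.
  have ov : ho_overlap w x y (zeta, eta) by split; rewrite ?zp ?ep.
  exists zeta, eta; split; [exact: ov|exact: zp|].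
  by have := desing_frame_dchange l Dx Dy ov; rewrite zp.
(* An orbifold point is the centre of any uniformizing disc that covers it, which forces
   [x = y = p]. *)
have z0 : zeta = 0 by apply: (order_neq1_center Dx xz); rewrite zp.
have e0 : eta = 0 by apply: (order_neq1_center Dy yz); rewrite ep.
by move: zp ep; rewrite z0 e0 !unif0 => -> ->.
Qed.

(* Away from the marked points the image avoids the toric divisors, and the
   logarithmic derivative identifies the tangent space with [N] tensor [C]. *)
Definition log_mx x q : 'M[C]_n :=
  diag_mx (\row_l (lam x q ord0 l * (vanish_poly (ho_chart w x l)).[q])^-1) *m
  chart_mx P C (ho_chart w x).

Lemma log_mx_unit x q : closed_disc x -> bp_nbhd E x q ->
  (forall i, q <> mark D i) -> log_mx x q \in unitmx.
Proof.
move=> Dx [zeta xz <-] qD; rewrite unitmx_mul; apply/andP; split; last first.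
  exact/chart_mx_unitC/ho_chartP.
rewrite unitmxE unitfE det_diag; apply/prodf_neq0 => l _.
rewrite mxE invr_neq0// mulf_neq0 ?vanish_poly_neq0//.
by rewrite (lamE Dx xz) local_unit_neq0.
Qed.

Lemma resing_log x zeta v j : closed_disc x -> ho_dom w x zeta ->
  (forall i, unif D x zeta <> mark D i) ->
  extend (ho_chart w x) 0 (resing w x zeta v) ord0 j = Zc x zeta ord0 j *
    (v *m diag_mx (\row_l (lam x (unif D x zeta) ord0 l *
       (vanish_poly (ho_chart w x l)).[unif D x zeta])^-1) *m
     select_mx (ho_chart w x)) ord0 j.
Proof.
move=> Dx xz xD; have o1 := order_at_out xD; set q := unif D x zeta.
have sI := chart_inj Dx.
have l0 l : lam x q ord0 l != 0 by rewrite (lamE Dx xz) local_unit_neq0.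
pose c := v *m diag_mx (\row_l (lam x q ord0 l)^-1).
have dE (a b : 'rV[C]_n) l : (a *m diag_mx b) ord0 l = a ord0 l * b ord0 l.
  by rewrite mul_mx_diag mxE.
have vE : v = c *m diag_mx (lam x q).
  by apply/rowP => l; rewrite dE /c dE [X in _ * X * _]mxE divfK.
rewrite {1}vE (resing_frame _ Dx xz o1) mxE (sigmaE j Dx xz o1) -/q.
have [/codomP[l ->]|js] := boolP (j \in codom (ho_chart w x)); last first.
  by rewrite !(row_select_out _ js) !mulr0.
rewrite !(row_select_in sI) /c !dE [X in _ * (_ * X) = _]mxE [X in _ = _ * (_ * X)]mxE.
have := l0 l; have := vanish_poly_neq0 (ho_chart w x l) xD; rewrite -/q.
move: (sigma _ _ _) (v _ _) (lam _ _ _ _) (vanish_poly _).[q] => a b c' d d0 c0.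
by field; rewrite c0 d0.
Qed.

(** Dividing the relation in [dchange] by the nonzero coordinates at [eta] leaves a discrepancy in
    [lie_KC], which the matrix of stacky vectors kills. *)
Lemma same_log x y p v v' : closed_disc x -> closed_disc y ->
  (forall i, p <> mark D i) -> bp_same E x y p v v' ->
  v *m log_mx x p = v' *m log_mx y p.
Proof.
move=> Dx Dy pD; have o1 := order_at_out pD; rewrite /= /desing_same o1 eqxx.
move=> [zeta [eta [ov zp [a /lie_KCP aA eqE]]]].
have [/= xz yz xy _] := ov.
have xD : forall i, unif D x zeta <> mark D i by rewrite zp.
have yD : forall i, unif D y eta <> mark D i by rewrite -xy zp.
pose c z q b : 'rV[C]_m := b *m diag_mx (\row_l (lam z q ord0 l *
       (vanish_poly (ho_chart w z l)).[q])^-1) *m select_mx (ho_chart w z).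
have cE : c y p v' = c x p v + a.
  apply/rowP => j; rewrite [RHS]mxE.
  have Z0 : Zc y eta ord0 j != 0 by exact: homog_neq0.
  have Ej : extend (ho_chart w y) 0 (resing w y eta v') ord0 j =
      ho_trans w x y zeta eta ord0 j * extend (ho_chart w x) 0 (resing w x zeta v) ord0 j +
      a ord0 j * Zc y eta ord0 j.
    by rewrite eqE [LHS]mxE; congr (_ + _); rewrite mxE.
  rewrite (resing_log _ _ Dy yz yD) (resing_log _ _ Dx xz xD) -xy zp in Ej.
  rewrite mulrA -(homog_trans j Dx Dy ov) -/(c y p v') -/(c x p v) in Ej.
  by rewrite [a _ _ * _]mulrC -mulrDr in Ej; exact: (mulfI Z0).
have cA z q b : c z q b *m A = b *m log_mx z q.
  by rewrite /c /log_mx chart_mxE -mul_select_mx !mulmxA.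
by rewrite -!cA cE mulmxDl aA addr0.
Qed.

(** * Comparison of an arbitrary global frame with [desing_frame] *)

Lemma frame_log Psi x q : global_frame E Psi -> closed_disc x -> bp_nbhd E x q ->
  (forall i, q <> mark D i) -> Psi x q *m log_mx x q = Psi q q *m log_mx q q.
Proof.
move=> [_ _ same] Dx xq qD; have [zeta xz zq] := xq.
have Dq : closed_disc q by rewrite -zq; exact: ho_dom_disc xz.
have qq := bp_nbhd_self Dq.
apply: row_mulmx_eq => l.
exact: (same_log Dx Dq qD (same x q q Dx Dq xq qq l)).
Qed.

Definition frame_ratio (Psi : C -> C -> 'M[C]_n) (q : C) : C :=
  \det (Psi q q) / \det (desing_frame q q).

Lemma frame_ratioE Psi x q : global_frame E Psi -> closed_disc x -> bp_nbhd E x q ->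
  (forall i, q <> mark D i) ->
  frame_ratio Psi q = \det (Psi x q) / \det (desing_frame x q).
Proof.
move=> Pg Dx xq qD; have [zeta xz zq] := xq.
have Dq : closed_disc q by rewrite -zq; exact: ho_dom_disc xz.
have qq := bp_nbhd_self Dq.
exact: (det_ratio_eq (desing_frame_unit Dx xq) (desing_frame_unit Dq qq)
  (log_mx_unit Dx xq qD) (log_mx_unit Dq qq qD) (frame_log Pg Dx xq qD)
  (frame_log desing_frame_global Dx xq qD)).
Qed.

Lemma near_bp_nbhd p : closed_disc p ->
  \forall q \near p, closed_disc q -> bp_nbhd E p q.
Proof.
move=> Dp; set r := order_at D p; have r0 : (0 < r)%N by exact: order_at_gt0.
have rho0 := ho_radius_gt0 w Dp.
have d0 : 0 < ho_radius w p ^+ r by rewrite exprn_gt0.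
have H : \forall q \near (p : C), `|p - q| < ho_radius w p ^+ r.
  exact: (@nbhsx_ballx C C).
apply: filterS H => q pq Dq; pose zeta : C := r.-root (q - p).
have zE : zeta ^+ r = q - p by rewrite rootCK.
have uE : unif D p zeta = q by rewrite /unif zE addrC subrK.
exists zeta => //; split; last by rewrite uE.
by rewrite -(ltr_pXn2r r0) ?nnegrE ?(ltW rho0)// -normrX zE distrC.
Qed.

(** Near [p] the ratio may be computed in the chart at [p]: off the marks by [frame_ratioE], and the
    only mark close to [p] can be [p] itself, where that chart is used by definition. *)
Lemma frame_ratio_continuous Psi : global_frame E Psi ->
  {within @closed_disc R, continuous (frame_ratio Psi)}.
Proof.
move=> Pg; apply/subspace_continuousP => p Dp; have [Pc Pu _] := Pg.
have pp := bp_nbhd_self Dp.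
have F1 : \forall q \near within (@closed_disc R) (nbhs p), bp_nbhd E p q.
  by rewrite near_withinE; exact: near_bp_nbhd.
have Fid : id @ within (@closed_disc R) (nbhs p) --> p by exact: cvg_within.
have L : (fun q => \det (Psi p q) / \det (desing_frame p q)) @
    within (@closed_disc R) (nbhs p) --> frame_ratio Psi p.
  apply: cvgM.
    apply: cvg_det.
    exact: (within_continuous_cvg (Pc _ Dp) pp Fid F1).
  apply: cvgV.
    by have := desing_frame_unit Dp pp; rewrite unitmxE unitfE.
  apply: cvg_det.
  exact: (within_continuous_cvg (desing_frame_continuous Dp) pp Fid F1).
apply: cvg_trans L; apply: near_eq_cvg.
have F2 : \forall q \near within (@closed_disc R) (nbhs p),
    forall i, q = mark D i -> q = p.
  exact: (Fid _ (near_nonmark (D := D) p)).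
apply: filterS2 F1 F2 => q pq qm.
have [[i qi]|qD] := markP (D := D) q; first by rewrite (qm _ qi).
exact: (esym (frame_ratioE Pg Dp pq qD)).
Qed.

Lemma frame_ratio_neq0 Psi p : global_frame E Psi -> closed_disc p ->
  frame_ratio Psi p != 0.
Proof.
move=> [_ Pu _] Dp; have pp := bp_nbhd_self Dp.
have := Pu _ _ Dp pp; have := desing_frame_unit Dp pp.
by rewrite !unitmxE !unitfE => *; rewrite mulf_neq0 ?invr_neq0.
Qed.

(** * The Maslov index *)

Local Notation toC := (map_mx (@ofR R)).
Local Notation ii := ('i%C : C).

Lemma frame_inv_unit q : (forall i, q <> mark D i) -> frame_inv q \in unitmx.
Proof.
move=> qD; rewrite unitmxE unitfE det_frame_inv; apply/prodf_neq0 => j _.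
exact: vanish_poly_neq0.
Qed.

Lemma desing_frame_log x q : closed_disc x -> bp_nbhd E x q -> (forall i, q <> mark D i) ->
  desing_frame x q *m log_mx x q = invmx (frame_inv q).
Proof.
move=> Dx [zeta xz <-] qD; set q0 := unif D x zeta.
have uM := frame_inv_unit qD; have uN := facet_row_unit Dx xz.
rewrite /desing_frame /log_mx.
have -> : diag_mx (lam x q0) = diag_mx (\row_l lam x q0 ord0 l).
  by congr diag_mx; apply/rowP => l; rewrite mxE.
apply: (invmx_factor_diag uN uM) => [l|l|].
- by rewrite (lamE Dx xz) local_unit_neq0.
- exact: vanish_poly_neq0.
have -> : chart_mx P C (ho_chart w x) *m frame_inv q0 =
    rowsub (ho_chart w x) (A *m frame_inv q0).
  by rewrite chart_mxE -!mul_select_mx mulmxA.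
rewrite frame_invE; apply/matrixP => l i.
by rewrite [LHS]mxE !mul_diag_mx !mxE.
Qed.

(** Divided by the nonzero homogeneous coordinates, the orbit directions become [i R^m + lie_KC],
    which the stacky matrix maps onto [i R^n]; the frame contributes [invmx (frame_inv p)]. *)
Lemma boundary_real_basis p : `|p| = 1 ->
  real_basis (ii *: frame_inv p) [set v | bp_real E p (v *m desing_frame p p)].
Proof.
move=> p1; have Dp : closed_disc p by rewrite /closed_disc/= p1.
have pD : forall i, p <> mark D i.
  by move=> i pi; have := mark_interior D i; rewrite -pi p1 ltxx.
have o1 := order_at_out pD; have uM := frame_inv_unit pD.
have p0 : ho_dom w p 0 by exact: ho_dom0.
have pD' : forall i, unif D p 0 <> mark D i by rewrite unif0.
have Z0 j : Zc p 0 ord0 j != 0 by exact: homog_neq0.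
have ii0 : ii != 0 by rewrite eq_complex /= oner_eq0 andbF.
have sI := chart_inj Dp; have cP := ho_chartP w Dp.
pose c (v : 'rV[C]_n) : 'rV[C]_m := v *m desing_frame p p *m diag_mx (\row_l (lam p p ord0 l *
       (vanish_poly (ho_chart w p l)).[p])^-1) *m select_mx (ho_chart w p).
have extE v j : extend (ho_chart w p) 0 (v *m desing_frame p p) ord0 j =
    Zc p 0 ord0 j * c v ord0 j.
  have rE xi : resing w p 0 xi = xi.
    by apply/rowP => l; rewrite mxE weight_order1// expr0 mul1r.
  by have := resing_log (v *m desing_frame p p) j Dp p0 pD'; rewrite rE unif0.
have cA v : c v *m A = v *m invmx (frame_inv p).
  rewrite -(desing_frame_log Dp (bp_nbhd_self Dp) pD) /c /log_mx chart_mxE.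
  by rewrite -mul_select_mx !mulmxA.
split; last first.
  move=> r; rewrite -scalemxAr => /eqP; rewrite scaler_eq0 (negbTE ii0)/= => /eqP r0.
  have : toC r = 0 by rewrite -[toC r](mulmxK uM) r0 mul0mx.
  by move=> /rowP H; apply/rowP => l; have := H l; rewrite !mxE => -[].
apply/seteqP; split=> [v /= [r [a [/lie_KCP aA vE]]]|v /= [r _ <-]].
  exists (r *m stacky_mx P R) => //.
  have cE : c v = ii *: toC r + a.
    apply/rowP => j; apply: (mulfI (Z0 j)); rewrite -extE vE mxE imag_rowE.
    by rewrite mulrC.
  rewrite -toC_stacky -scalemxAr scalemxAl scalemxAl.
  have -> : ii *: toC r *m A = c v *m A by rewrite cE mulmxDl aA addr0.
  by rewrite cA mulmxKV.
(* A real preimage of [r] supported on the chart facets; it exists because the chart matrix is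
   invertible over the reals. *)
pose r' : 'rV[R]_m := r *m invmx (chart_mx P R (ho_chart w p)) *m select_mx (ho_chart w p).
have r'A : r' *m stacky_mx P R = r.
  rewrite /r' -mulmxA mul_select_mx -chart_mxE mulmxKV//; exact: chart_mx_unit.
set v0 := toC r *m (ii *: frame_inv p).
exists r', (c v0 - ii *: toC r'); split.
  apply/lie_KCP; rewrite mulmxBl cA -scalemxAl toC_stacky r'A /v0.
  by rewrite -scalemxAr -scalemxAl mulmxK// subrr.
by apply/rowP => j; rewrite extE imag_rowE addrC subrK [RHS]mxE mulrC.
Qed.

Definition total_floor_mult i := (\sum_j f i j)%N.

Lemma det_frame_invE (q : C) :
  \det (frame_inv q) = \prod_i (q - mark D i) ^+ total_floor_mult i.
Proof.
rewrite det_frame_inv; under eq_bigr do rewrite vanish_polyE.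
rewrite exchange_big/=; apply: eq_bigr => i _.
exact: (esym (expr_sum _ _ _ _)).
Qed.

(** The term [(pi / 2) *+ n] comes from [i^n], each factor [p - z_i] turns by [2 pi t] up to a
    periodic term, and the outer doubling is the square of the determinant. *)
Definition boundary_angle (t : R) : R :=
  ((pi / 2) *+ n + \sum_i
     (2 * pi * t + right_arg (1 - mark D i / expi (2 * pi * t))) *+
       total_floor_mult i) *+ 2.

Lemma boundary_angleE t (p := expi (2 * pi * t) : C) :
  phase (\det (ii *: frame_inv p)) ^+ 2 = expi (boundary_angle t).
Proof.
rewrite /boundary_angle expiMn expiD expiMn expi_pihalf expi_sum; congr (_ ^+ 2).
rewrite detZ phaseM phaseX; congr (_ ^+ _ * _).
  by rewrite -[in RHS]expi_pihalf -phase_expi expi_pihalf.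
rewrite det_frame_invE phase_prod; apply: eq_bigr => i _.
by rewrite phaseX phase_sub ?mark_interior// expiMn.
Qed.

Lemma boundary_angle_continuous : continuous boundary_angle.
Proof.
move=> t; rewrite /boundary_angle.
apply: (@cvg_natmul R R (nbhs t) _ (fun t => (pi / 2) *+ n + \sum_i
     (2 * pi * t + right_arg (1 - mark D i / expi (2 * pi * t))) *+
       total_floor_mult i)).
apply: (@cvgD R R R (nbhs t) _ (fun=> (pi / 2) *+ n)); first exact: cvg_cst.
apply: cvg_sumr => i _.
apply: (@cvg_natmul R R (nbhs t) _
  (fun t => 2 * pi * t + right_arg (1 - mark D i / expi (2 * pi * t)))).
exact/continuous_angle/mark_interior.
Qed.

Definition maslov_value : nat := (2 * \sum_i total_floor_mult i)%N.

Lemma boundary_angle_diff :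
  boundary_angle 1 - boundary_angle 0 = 2 * pi * (maslov_value%:Z)%:~R.
Proof.
rewrite /boundary_angle mulr1 mulr0 expi_2pi expi0 -mulrnBl.
rewrite opprD addrACA subrr add0r -sumrB.
under eq_bigr do rewrite -mulrnBl add0r addrK.
by rewrite sumrMnr /maslov_value -pmulrn natrM -mulrnA mulnC -[LHS]mulr_natr natrM.
Qed.

Lemma desing_frame_maslov : is_desing_maslov_index w maslov_value%:Z.
Proof.
exists desing_frame; first exact: desing_frame_global.
exists boundary_angle; split; last exact: boundary_angle_diff.
  by apply: continuous_subspaceT; exact: boundary_angle_continuous.
move=> t t01 p; exists (ii *: frame_inv p); first exact/boundary_real_basis/norm_expi.
by rewrite phaseV_sqr boundary_angleE.
Qed.

(** [G] passes from one frame to the other and has determinant [frame_ratio]. The real factor given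
    by [real_basis_det] disappears in the square. *)
Lemma frame_ratio_phase Psi t A1 (p := expi (2 * pi * t) : C) :
  global_frame E Psi -> real_basis A1 [set v | bp_real E p (v *m Psi p p)] ->
  phase (\det A1) ^+ 2 * phase (frame_ratio Psi p) ^+ 2 = expi (boundary_angle t).
Proof.
move=> Pg A1P; have p1 : `|p| = 1 by exact: norm_expi.
have Dp : closed_disc p by rewrite /closed_disc/= p1.
have pD : forall i, p <> mark D i.
  by move=> i pi; have := mark_interior D i; rewrite -pi p1 ltxx.
have pp := bp_nbhd_self Dp; have ud := desing_frame_unit Dp pp.
have uPsi : Psi p p \in unitmx by have [_ + _] := Pg; exact.
pose G := Psi p p *m invmx (desing_frame p p).
have uG : G \in unitmx by rewrite unitmx_mul uPsi unitmx_inv ud.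
have uA : ii *: frame_inv p \in unitmx.
  rewrite unitmxZ ?frame_inv_unit// unitfE -expi_pihalf; exact: expi_neq0.
have A1P' : real_basis A1 [set v | [set v | bp_real E p (v *m desing_frame p p)] (v *m G)].
  move: A1P; congr (real_basis _ _); apply/funext => v; rewrite /=.
  by congr (bp_real E p _); rewrite /G mulmxA (mulmxKV ud).
have [s s0 sE] := real_basis_det uA uG (boundary_real_basis p1) A1P'.
rewrite -boundary_angleE -exprMn -phaseM -/p.
have -> : frame_ratio Psi p = \det G by rewrite det_mulmx det_inv.
by rewrite sE phaseM exprMn phase_ofR_sqr// mul1r.
Qed.

(** The angle [gam] of the frame ratio returns to its initial value by [disc_angle], so [phi] and
    [boundary_angle] have the same total variation. *)
Lemma desing_maslov_unique d : is_desing_maslov_index w d -> d = maslov_value%:Z.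
Proof.
move=> [Psi Pg [phi [phic phiE phid]]].
have [c [gam [gamc gam01 gamE]]] := disc_angle (frame_ratio_continuous Pg)
  (fun p Dp => frame_ratio_neq0 Pg Dp).
pose g t := phi t + gam t *+ 2 - boundary_angle t.
have gE t : 0 <= t <= 1 -> c ^+ 2 * expi (g t) = 1.
  move=> t01; have [A1 A1P A1E] := phiE t t01.
  have := frame_ratio_phase Pg A1P; rewrite -phaseV_sqr A1E /phase gamE exprMn => hg.
  apply: (mulIf (expi_neq0 (boundary_angle t))); rewrite mul1r -[RHS]hg.
  by rewrite -mulrA -expiD /g subrK expiD expiMn mulrCA.
have c0 : c ^+ 2 != 0.
  apply/eqP => c0; have := gE 0; rewrite c0 mul0r lexx ler01 => /(_ isT)/esym/eqP.
  by rewrite oner_eq0.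
(* Since [expi (g t)] is known only up to the constant [c ^+ 2], subtracting [g 0] is what makes
   [expi_eq1_const] applicable. *)
have : g 1 - g 0 = g 0 - g 0.
  apply: (@expi_eq1_const R (fun t => g t - g 0)) => [|t t01].
    apply/subspace_continuousP => t tI; set F := within _ _.
    have phit : phi @ F --> phi t.
      by have /subspace_continuousP/(_ t tI) := phic.
    have Fid : id @ F --> t by exact: cvg_within.
    have bt : boundary_angle @ F --> boundary_angle t.
      by move=> B /boundary_angle_continuous; exact: Fid.
    have gt : gam @ F --> gam t by move=> B /gamc; exact: Fid.
    have g2t := @cvg_natmul R R F _ gam (gam t) 2 gt.
    suff : (fun t => g t - g 0) @ F --> g t - g 0 by [].
    apply: (@cvgB R R R F _ g (fun=> g 0)); last exact: cvg_cst.
    apply: (@cvgB R R R F _ (fun t => phi t + gam t *+ 2)); last exact: bt.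
    apply: (@cvgD R R R F _ phi (fun t => gam t *+ 2)); first exact: phit.
    exact: g2t.
  apply: (mulfI c0); rewrite mulr1; apply: (mulIf (expi_neq0 (g 0))).
  by rewrite -mulrA -expiD subrK gE// gE ?mulr1 ?lexx ?ler01.
rewrite subrr /g gam01 => /eqP; rewrite subr_eq0 => /eqP e.
have : phi 1 - phi 0 = boundary_angle 1 - boundary_angle 0.
  by move: e; move: (gam 0 *+ 2) (phi 1) (phi 0) (boundary_angle 1) (boundary_angle 0)
    => a b c1 d1 e1; lra.
rewrite phid boundary_angle_diff => /mulfI; rewrite mulf_neq0 ?gt_eqF ?pi_gt0//.
by move=> /(_ isT)/intr_inj.
Qed.

End HomogeneousCoordinates.

(** * From rational multiplicities to vanishing orders, and the conclusion *)

Lemma floor_natdiv (a b : nat) : (0 < b)%N ->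
  Num.floor (a%:R / b%:R : rat) = (a %/ b)%N%:Z.
Proof.
move=> b0; apply: floor_def; rewrite -!pmulrn.
have bQ : (0 : rat) < b%:R by rewrite ltr0n.
rewrite ler_pdivlMr// ltr_pdivrMr// -!natrM ler_nat ltr_nat leq_divM/=.
by rewrite addn1 ltn_ceil.
Qed.

Lemma vanishing_factor (R : realType) (n m k : nat) (P : labeled_polytope R n m)
  (u : 'rV[R]_n) (D : orbidisc R k) (w : holo_orbidisc P u D) (i : 'I_k) (j : 'I_m)
  (a : nat) : intersects_with_multiplicity w i j (a%:R / (mark_order D i)%:R) ->
  exists h : Cx R -> Cx R,
    [/\ h @ nbhs (0 : Cx R) --> h 0, h 0 != 0 &
      \forall zeta \near (0 : Cx R),
        extend (ho_chart w (mark D i)) 1 (ho_lift w (mark D i) zeta) ord0 j =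
        zeta ^+ a * h zeta].
Proof.
move=> [b [h [hd h0 hE]]].
have m0 : (mark_order D i)%:R != 0 :> rat by rewrite pnatr_eq0 -lt0n mark_order_gt0.
move=> /(mulIf (invr_neq0 m0))/eqP; rewrite eqr_nat => /eqP ->.
exists h; split => //; have /derivable1_diffP := nbhs_singleton hd.
exact: differentiable_continuous.
Qed.

Theorem theorem5p2 (R : realType) (n m k : nat) (P : labeled_polytope R n m)
  (u : 'rV[R]_n) (hu : interior (polytope P) u) (D : orbidisc R k)
  (w : holo_orbidisc P u D) (mult : 'I_k -> 'I_m -> nat)
  (hmult : forall (i : 'I_k) (j : 'I_m),
     intersects_with_multiplicity w i j
       ((mult i j)%:R / (mark_order D i)%:R))
  (hoff : forall p : Cx R, closed_disc p -> (forall i, p <> mark D i) ->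
     forall j : 'I_m, ~ toric_divisor P j (ho_map w p)) :
  forall d : int, is_desing_maslov_index w d <->
    d = 2 * \sum_(i < k) \sum_(j < m)
              Num.floor ((mult i j)%:R / (mark_order D i)%:R : rat).
Proof.
have /choice[h hP] : forall ij : 'I_k * 'I_m, exists h : Cx R -> Cx R,
    [/\ h @ nbhs (0 : Cx R) --> h 0, h 0 != 0 &
      \forall zeta \near (0 : Cx R),
        extend (ho_chart w (mark D ij.1)) 1 (ho_lift w (mark D ij.1) zeta) ord0 ij.2 =
        zeta ^+ mult ij.1 ij.2 * h zeta].
  by move=> [i j]; exact: vanishing_factor (hmult i j).
have h_cont i j : h (i, j) @ nbhs (0 : Cx R) --> h (i, j) 0 by have [] := hP (i, j).
have h_neq0 i j : h (i, j) 0 != 0 by have [] := hP (i, j).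
have hE i j : \forall zeta \near (0 : Cx R),
    extend (ho_chart w (mark D i)) 1 (ho_lift w (mark D i) zeta) ord0 j =
    zeta ^+ mult i j * h (i, j) zeta by have [] := hP (i, j).
have Bu i : chart_mx P (Cx R) (ho_chart w (mark D i)) \in unitmx.
  exact/chart_mx_unitC/ho_chartP/closed_disc_mark.
(* At each mark the rows are the stacky vectors of the chart there, and the exponents are the floors
   for its [n] facets; all other facets have exponent 0. *)
have [M [dM rM]] := polymx_of_divisors
  (fun i l => floor_mult (D := D) mult i (ho_chart w (mark D i) l)) (@mark_inj _ _ D) Bu.
have [lam lamP] := exists_unit_descent (h := fun i j => h (i, j)) h_cont h_neq0 hE.
have lam_cont x : closed_disc x ->
    {within [set unif D x zeta | zeta in ho_dom w x], continuous (lam x)}.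
  by move=> /lamP[].
have lamE x : closed_disc x -> forall zeta, ho_dom w x zeta ->
    lam x (unif D x zeta) = local_unit w mult (fun i j => h (i, j)) x zeta.
  by move=> /lamP[].
have -> : 2 * \sum_(i < k) \sum_(j < m)
    Num.floor ((mult i j)%:R / (mark_order D i)%:R : rat) =
    (maslov_value (D := D) mult)%:Z :> int.
  rewrite /maslov_value PoszM (big_morph Posz PoszD (erefl _)); congr (_ * _).
  apply: eq_bigr => i _; rewrite (big_morph Posz PoszD (erefl _)).
  by apply: eq_bigr => j _; rewrite floor_natdiv ?mark_order_gt0.
move=> d; split=> [dP|->].
  exact: (desing_maslov_unique h_neq0 hE hoff dM rM lam_cont lamE dP).
exact: (desing_frame_maslov h_neq0 hE hoff dM rM lam_cont lamE).
Qed.
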